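(* Let $p$ be a prime, let $0<q<1$ and let $1/p<\alpha\le 1$. There exist constants $C>0$, $K>0$ and $n_0$, depending only on $p,q,\alpha$, such that for every $n\ge n_0$ (so that $p\ll\sqrt n$) and every integer $0\le k\le (1+\alpha)n$, $$\left|\,\mathbb{P}\big(\operatorname{corank}(M/p)=1+k\big)-\frac{1}{p^{k^2+k}}\,\frac{\prod_{i=k+2}^{\infty}(1-p^{-i})}{\prod_{i=1}^{k}(1-p^{-i})}\right|\le K\exp(-Cn/p^2),$$ where $M$ is the Laplacian matrix of the random directed bipartite graph with parts of sizes $n$ and $\lfloor\alpha n\rfloor$ and edge probability $q$, and $M/p$ is its reduction modulo $p$.
   Context: Random graph and matrix. Write $N=\lfloor\alpha n\rfloor$; the paper omits floors and writes $\alpha n$ for $N$ and $(1+\alpha)n$ for $n+N$. The random directed bipartite graph has vertex parts $V_1$ (vertices $1,\dots,n$) and $V_2$ (vertices $n+1,\dots,n+N$); each of the $2nN$ possible directed edges between the parts (both directions, from $V_1$ to $V_2$ and from $V_2$ to $V_1$) is included independently with probability $q$, where $q\in(0,1)$ is a constant independent of $n$. There are no other edges. The Laplacian $M$ is the $(n+N)\times(n+N)$ matrix whose off-diagonal entry in position $(u,v)$ is $1$ if the edge $u\to v$ is present and $0$ otherwise, and whose diagonal entry in position $(u,u)$ is minus the sum of the off-diagonal entries in row $u$. Thus every row of $M$ sums to zero, and the rows of $M$ are independent random vectors. Ranks are over $\mathbb{F}_p$: $\operatorname{corank}(M/p)=(n+N)-\operatorname{rank}_{\mathbb{F}_p}(M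 \bmod p)$. An empty product equals $1$. Convention of the paper: $p$ is fixed and treated as a constant, and constants $C$ may depend on $p,q,\alpha$. *)

(* Defs.v *)
From HB Require Import structures.
From mathcomp Require Import all_boot all_order all_algebra.
From mathcomp Require Import all_classical all_reals all_analysis.

Set Implicit Arguments.
Unset Strict Implicit.
Unset Printing Implicit Defensive.

Import Order.TTheory GRing.Theory Num.Theory.
Import numFieldNormedType.Exports.

Local Open Scope ring_scope.

(* A digraph on m vertices is its set of arcs (u, v), read u -> v. *)
Definition digraph (m : nat) : finType := {set 'I_m * 'I_m}.

Definition laplacian (m : nat) (G : digraph m) : 'M[int]_m :=
  \matrix_(u, v)
    if u == v then - \sum_(w < m | w != u) ((u, w) \in G)%:Z
    else ((u, v) \in G)%:Z.

Definition mx_mod (p m : nat) (A : 'M[int]_m) : 'M['F_p]_m := map_mx intr A.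

Definition corank (F : fieldType) (m : nat) (A : 'M[F]_m) : nat :=
  (m - \rank A)%N.

(* V_1 is {u | u < n} and V_2 its complement in 'I_(n + N). *)
Definition bip_arcs (n N : nat) : {set 'I_(n + N) * 'I_(n + N)} :=
  [set e : 'I_(n + N) * 'I_(n + N) | ((e.1 < n) != (e.2 < n))%N].

(* The law under which the arcs of [bip_arcs n N] are independent, each present
   with probability q, and no other arc is ever present. *)
Definition bip_weight (R : realType) (n N : nat) (q : R)
    (G : digraph (n + N)) : R :=
  if G \subset bip_arcs n N
  then \prod_(e in bip_arcs n N) (if e \in G then q else 1 - q)
  else 0.

Definition bip_prob (R : realType) (n N : nat) (q : R)
    (A : pred (digraph (n + N))) : R :=
  \sum_(G : digraph (n + N) | A G) bip_weight q G.

Definition infprod (R : realType) (m : nat) (f : nat -> R) : R :=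
  limn (fun l : nat => \prod_(m <= i < l) f i).

Definition limit_law (R : realType) (p k : nat) : R :=
  (p%:R ^+ (k ^ 2 + k))^-1 *
  (infprod k.+2 (fun i => 1 - p%:R ^- i) /
   \prod_(1 <= i < k.+1) (1 - p%:R ^- i)).

(* Main.v *)
(* Expose the rows of M one at a time, the n rows of V_1 first, and follow the
   space K_i of the vectors over F_p killed by the first i rows, whose final
   dimension is the corank.  A row law gives weight 1/p up to an exponentially
   small error to the hyperplane orthogonal to x, unless x is nearly constant on
   the part of the graph opposite to that row.  Hence, as long as K_i contains no
   vector that is nearly constant on V_1 besides the constants, a row u of V_2
   satisfies P(K_(i+1) = K_i) = p / |K_i| up to an exponentially small error, and
   dim K_i follows the chain of a uniform random matrix with one row more than it
   has columns, whose law is explicit.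

   It remains to see that, with L = eps n rows left, K_i has the generic dimension
   L and contains no bad vector.  Both follow from the first moment of |K_i|: the
   generic vectors contribute p ^ L, those nearly constant on V_1 an exponentially
   small amount.  Those nearly constant on V_2 contribute at most p ^ z (up to
   small exponential factors), where z is the number of zero diagonal entries in
   the rows of V_1; z is close to n / p, so alpha > 1 / p is what makes this
   negligible outside of an exponentially unlikely event. *)
Require Import Defs.
From HB Require Import structures.
From mathcomp Require Import all_boot all_order all_algebra.
From mathcomp Require Import all_classical all_reals all_analysis.
From mathcomp Require Import ring lra zify.

Set Implicit Arguments.
Unset Strict Implicit.
Unset Printing Implicit Defensive.

Import Order.TTheory GRing.Theory Num.Theory.
Import numFieldNormedType.Exports.

Local Open Scope ring_scope.

(** A first moment is enough because i rows always leave corank at least m - i, where m = n + N: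
    |K_i| is at least p ^ L with L rows left, and at least p ^ (L + 1) when the dimension is not
    generic. A mean of (1 + delta) p ^ L therefore bounds the probability of excess dimension by
    about delta. The mean has to be truncated: if u in V_1 has out-degree divisible by p, its
    diagonal entry vanishes and the row no longer determines x u, so rare large values of z could
    dominate the mean through vectors nearly constant on V_2. V_1 comes first because the closing
    phase then consists of rows of V_2 only, which see a vector through its jumps to V_1; near
    constancy on V_2 is harmless there. The bound alpha <= 1 matters for vectors that are mostly 0
    on V_1 but not on V_2: they contribute about (1/p) ^ n * (2 - 1/p) ^ N, small because N <= n and
    (2 - 1/p) / p < 1. The small parameter sigma is fixed first; the threshold 1/D for being nearly
    constant, and with it L = N / D, is chosen afterwards. *)

(** * Expectations under finite product laws *)

Section ProductMeasure.
Variables (R : realType) (I T : finType).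
Implicit Types (w : I -> T -> R) (f : {ffun I -> T}) (F G : {ffun I -> T} -> R).

Definition expect w F : R := \sum_(f : {ffun I -> T}) (\prod_i w i (f i)) * F f.

Definition update f (i : I) (t : T) : {ffun I -> T} :=
  [ffun j => if j == i then t else f j].

Definition is_law w := (forall i t, 0 <= w i t) /\ forall i, \sum_t w i t = 1.

Lemma expect_prod w (g : I -> T -> R) :
  expect w (fun f => \prod_i g i (f i)) = \prod_i \sum_t w i t * g i t.
Proof.
rewrite bigA_distr_bigA /expect; apply: eq_bigr => f _.
by rewrite big_split.
Qed.

Lemma expect_ge0 w F : is_law w -> (forall f, 0 <= F f) -> 0 <= expect w F.
Proof.
move=> [w0 _] F0; apply: sumr_ge0 => f _; apply: mulr_ge0 => //.
by apply: prodr_ge0 => i _.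
Qed.

Lemma expectB w F G :
  expect w (fun f => F f - G f) = expect w F - expect w G.
Proof. by rewrite /expect -sumrB; apply: eq_bigr => f _; rewrite mulrBr. Qed.

Lemma expectD w F G :
  expect w (fun f => F f + G f) = expect w F + expect w G.
Proof. by rewrite /expect -big_split; apply: eq_bigr => f _; rewrite mulrDr. Qed.

Lemma expectZ w c F : expect w (fun f => c * F f) = c * expect w F.
Proof. by rewrite /expect mulr_sumr; apply: eq_bigr => f _; rewrite mulrCA. Qed.

Lemma expect_sum w (J : finType) (P : pred J) (F : J -> {ffun I -> T} -> R) :
  expect w (fun f => \sum_(j | P j) F j f) = \sum_(j | P j) expect w (F j).
Proof.
rewrite /expect exchange_big; apply: eq_bigr => f _.
by rewrite mulr_sumr.
Qed.

Lemma eq_expect w F G : F =1 G -> expect w F = expect w G.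
Proof. by move=> FG; apply: eq_bigr => f _; rewrite FG. Qed.

Lemma expect_le w F G :
  is_law w -> (forall f, F f <= G f) -> expect w F <= expect w G.
Proof.
move=> wP FG; rewrite -subr_ge0 -expectB; apply: expect_ge0 => // f.
by rewrite subr_ge0.
Qed.

Lemma expect_cst w c : is_law w -> expect w (fun=> c) = c.
Proof.
move=> [_ w1]; have := expect_prod w (fun _ _ => 1).
rewrite [X in _ = X]big1 => [e1|i _]; last first.
  by rewrite -[RHS](w1 i); apply: eq_bigr => t _; rewrite mulr1.
rewrite (@eq_expect _ _ (fun f => c * \prod_(i : I) 1)) ?expectZ ?e1 ?mulr1//.
by move=> f; rewrite big1 ?mulr1.
Qed.

Lemma ler_norm_expect w F : is_law w ->
  `|expect w F| <= expect w (fun f => `|F f|).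
Proof.
move=> [w0 _]; apply: le_trans (ler_norm_sum _ _ _) _.
apply: ler_sum => f _; rewrite normrM ger0_norm//.
by apply: prodr_ge0.
Qed.

(* The involution (f, t) |-> (f[i := t], f i) preserves the product weight. *)
Lemma expect_resample w i F : is_law w ->
  expect w F = expect w (fun f => \sum_t w i t * F (update f i t)).
Proof.
move=> [w0 w1].
pose W f := \prod_j w j (f j).
pose s (ft : {ffun I -> T} * T) := (update ft.1 i ft.2, ft.1 i).
have sK : involutive s.
  move=> [f t]; rewrite /s /= ffunE eqxx; congr pair.
  by apply/ffunP => j; rewrite !ffunE; case: eqP => // ->.
have sW ft : W (s ft).1 * w i (s ft).2 = W ft.1 * w i ft.2.
  rewrite /W (bigD1 i)//= [in RHS](bigD1 i)//= ffunE eqxx.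
  rewrite mulrAC [RHS]mulrAC [w i _ * _]mulrC; congr (_ * _).
  by apply: eq_bigr => j /negbTE ji; rewrite ffunE ji.
transitivity (\sum_(ft : {ffun I -> T} * T) W ft.1 * w i ft.2 * F ft.1).
  rewrite -(pair_bigA _ (fun f t => W f * w i t * F f))/=.
  apply: eq_bigr => f _; rewrite -mulr_suml -mulr_sumr w1 mulr1.
  by [].
rewrite (reindex_inj (inv_inj sK)).
under eq_bigr do rewrite sW.
rewrite -(pair_bigA _ (fun f t => W f * w i t * F (update f i t)))/=.
by apply: eq_bigr => f _; rewrite mulr_sumr; apply: eq_bigr => t _; rewrite mulrA.
Qed.

End ProductMeasure.

(** * Equidistribution modulo p of weighted Bernoulli sums *)

Section Anticoncentration.
Variables (R : realType) (p : nat) (p_prime : prime p).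

Lemma translate_generates (w b : 'F_p) : w != 0 -> exists k, (k < p)%N /\ w *+ k = b.
Proof.
move=> w0; exists (b / w : 'F_p); split.
  by have := ltn_ord (b / w : 'F_p); rewrite [X in (_ < X)%N]Fp_cast.
by rewrite -mulr_natr natr_Zp mulrC divfK.
Qed.

Definition l2 (f : 'F_p -> R) : R := \sum_a f a ^+ 2.

Lemma sum_translate (f : 'F_p -> R) (b : 'F_p) : \sum_a f (a - b) = \sum_a f a.
Proof. by rewrite [RHS](reindex_inj (addIr (- b))). Qed.

(** The inequality (x - z)^2 <= 2 (x - y)^2 + 2 (y - z)^2 turns a constant c into 2 c + 2 at each
    further step, and 4 ^ k dominates this recursion. *)
Lemma l2_translate_mulrn (f : 'F_p -> R) (w : 'F_p) k :
  l2 (fun a => f a - f (a - w *+ k)) <= 4 ^+ k * l2 (fun a => f a - f (a - w)).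
Proof.
set D := l2 (fun a => f a - f (a - w)).
have D0 : 0 <= D by apply: sumr_ge0 => a _; exact: sqr_ge0.
elim: k => [|k IHk].
  rewrite /l2 big1 ?mul1r// => a _.
  by rewrite mulr0n subr0 subrr expr0n.
have step : l2 (fun a => f a - f (a - w *+ k.+1)) <=
    2 * l2 (fun a => f a - f (a - w *+ k)) + 2 * D.
  have -> : D = \sum_a (f (a - w *+ k) - f (a - w *+ k - w)) ^+ 2.
    by rewrite (sum_translate (fun a => (f a - f (a - w)) ^+ 2)).
  rewrite /l2 !mulr_sumr -big_split; apply: ler_sum => a _ /=.
  have -> : a - w *+ k.+1 = a - w *+ k - w by rewrite mulrSr opprD addrA.
  set x := f a; set y := f (a - _); set z := f (_ - w).
  rewrite -subr_ge0.
  have -> : 2 * (x - y) ^+ 2 + 2 * (y - z) ^+ 2 - (x - z) ^+ 2 =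
            ((x - y) - (y - z)) ^+ 2 by ring.
  exact: sqr_ge0.
apply: le_trans step _.
have e1 : 1 <= 4 ^+ k :> R by rewrite exprn_ege1// ler1n.
rewrite exprS; nra.
Qed.

(** For f of mean zero, the squared distances to all p translates add up to [2 * p%:R * l2 f], and
    every translation is fewer than p steps of size w. The constant 4 ^ p is crude, but p is
    fixed. *)
Lemma poincare (f : 'F_p -> R) (w : 'F_p) : w != 0 -> \sum_a f a = 0 ->
  l2 f <= 4 ^+ p * l2 (fun a => f a - f (a - w)).
Proof.
move=> w0 f0; set D := l2 (fun a => f a - f (a - w)).
have D0 : 0 <= D by apply: sumr_ge0 => a _; exact: sqr_ge0.
have card_Fp : #|'F_p| = p by rewrite card_Fp.
have p0 : 0 < p%:R :> R by rewrite ltr0n prime_gt0.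
have bound (b : 'F_p) : l2 (fun a => f a - f (a - b)) <= 4 ^+ p * D.
  have [k [kp <-]] := translate_generates b w0.
  apply: le_trans (l2_translate_mulrn f w k) _.
  by apply: ler_wpM2r => //; rewrite ler_weXn2l ?ler1n// ltnW.
have : \sum_(b : 'F_p) l2 (fun a => f a - f (a - b)) = 2 * p%:R * l2 f.
  rewrite /l2 exchange_big /=.
  transitivity (\sum_a \sum_b (f a - f b) ^+ 2).
    apply: eq_bigr => a _.
    by rewrite [RHS](reindex_inj (inj_comp (addrI a) (@oppr_inj _))).
  have inner a : \sum_b (f a - f b) ^+ 2 = p%:R * f a ^+ 2 + l2 f.
    under eq_bigr do rewrite sqrrB.
    rewrite big_split /= sumrB sumr_const card_Fp.
    by rewrite sumrMnl -mulr_sumr f0 mulr0 mul0rn subr0 mulr_natl.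
  rewrite (eq_bigr _ (fun a _ => inner a)).
  rewrite big_split /= -mulr_sumr sumr_const card_Fp -mulr_natl.
  by rewrite /l2 -/(l2 f); ring.
move=> e; have : 2 * p%:R * l2 f <= p%:R * (4 ^+ p * D).
  rewrite -e; apply: le_trans (ler_sum _ (fun b _ => bound b)) _.
  by rewrite sumr_const card_Fp mulr_natl.
rewrite mulrAC mulrC ler_pM2l// => le2.
have : 0 <= l2 f by apply: sumr_ge0 => a _; exact: sqr_ge0.
lra.
Qed.

Variables (q : R) (q_gt0 : 0 < q) (q_lt1 : q < 1).

Definition l2_rate : R := 1 - q * (1 - q) / 4 ^+ p.

Lemma l2_rate_itv : 0 < l2_rate < 1.
Proof.
rewrite /l2_rate.
have e1 : 1 <= 4 ^+ p :> R by rewrite exprn_ege1// ler1n.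
have e2 : 0 < 4 ^+ p :> R by rewrite exprn_gt0.
have e3 : 0 < (4 ^+ p)^-1 :> R by rewrite invr_gt0.
have e4 : (4 ^+ p)^-1 <= 1 :> R by rewrite invf_le1.
have q2 : 0 < q * (1 - q) by rewrite mulr_gt0// subr_gt0.
have q3 : q * (1 - q) < 1 by nra.
by apply/andP; split; nra.
Qed.

(** Mixing f with its translate lowers the squared norm by exactly q (1 - q) times the squared norm
    of their difference, which [poincare] bounds from below. *)
Lemma l2_contraction (f : 'F_p -> R) (w : 'F_p) : w != 0 -> \sum_a f a = 0 ->
  l2 (fun a => (1 - q) * f a + q * f (a - w)) <= l2_rate * l2 f.
Proof.
move=> w0 f0; have := poincare w0 f0.
have -> : l2 (fun a => (1 - q) * f a + q * f (a - w)) =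
          l2 f - q * (1 - q) * l2 (fun a => f a - f (a - w)).
  have e : l2 f = (1 - q) * l2 f + q * \sum_a f (a - w) ^+ 2.
    rewrite (sum_translate (fun a => f a ^+ 2)) -mulrDl subrK mul1r//.
  rewrite e /l2 !mulr_sumr -big_split -sumrB.
  apply: eq_bigr => a _ /=; ring.
set D := l2 (fun a => f a - f (a - w)) => le.
rewrite /l2_rate mulrBl mul1r lerB// -!mulrA ler_pM2l// ler_pM2l ?subr_gt0//.
by rewrite mulrC ler_pdivrMr ?exprn_gt0// mulrC.
Qed.

Variables (I : finType) (w : I -> bool -> R) (w_law : is_law w) (y : I -> 'F_p).
Hypothesis w_bern : forall i, y i != 0 -> w i true = q /\ w i false = 1 - q.

(** A list of coordinates allows an induction that reveals them one at a time; [index_enum I] gives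
    back the full sum. *)
Definition point_prob (s : seq I) (a : 'F_p) : R :=
  expect w (fun r => (\sum_(i <- s) y i *+ r i == a)%:R).

Lemma point_prob_cons i s a : i \notin s ->
  point_prob (i :: s) a =
    w i false * point_prob s a + w i true * point_prob s (a - y i).
Proof.
move=> i_s; rewrite /point_prob (expect_resample i _ w_law).
rewrite -!expectZ -expectD; apply: eq_expect => f.
have upd b : \sum_(j <- i :: s) y j *+ update f i b j =
             y i *+ b + \sum_(j <- s) y j *+ f j.
  rewrite big_cons ffunE eqxx; congr (_ + _).
  rewrite [LHS]big_seq [RHS]big_seq; apply: eq_bigr => j js.
  by rewrite ffunE; case: eqP => // ji; rewrite -ji js in i_s.
rewrite big_bool !upd /= mulr0n mulr1n add0r addrC; congr (_ + _ * _).
by rewrite [in RHS]eq_sym subr_eq eq_sym addrC.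
Qed.

Lemma point_prob_ge0 s a : 0 <= point_prob s a.
Proof. by apply: expect_ge0 => // f; exact: ler0n. Qed.

Lemma sum_point_prob s : \sum_a point_prob s a = 1.
Proof.
rewrite -expect_sum -[RHS](expect_cst 1 w_law); apply: eq_expect => f.
rewrite (bigD1 (\sum_(i <- s) y i *+ f i))//= eqxx big1 ?addr0// => a.
by rewrite eq_sym => /negbTE ->.
Qed.

(** The empty sum is a point mass, at squared distance 1 - 1/p from uniform. Each coordinate with
    nonzero coefficient then contracts by [l2_rate], and the others change nothing. *)
Lemma l2_point_prob s : uniq s ->
  l2 (fun a => point_prob s a - p%:R^-1) <=
    l2_rate ^+ count (fun i => y i != 0) s.
Proof.
have card_Fp : #|'F_p| = p by rewrite card_Fp.
have p0 : p%:R != 0 :> R by rewrite pnatr_eq0 -lt0n prime_gt0.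
elim: s => [|i s IHs] /=.
  move=> _; rewrite expr0 /l2.
  have e a : (point_prob [::] a - p%:R^-1) ^+ 2 =
      (1 - 2 * p%:R^-1) * (a == 0)%:R + p%:R^-1 ^+ 2.
    rewrite /point_prob (eq_expect _ (G := fun=> (a == 0)%:R)); last first.
      by move=> f; rewrite big_nil eq_sym.
    by rewrite expect_cst//; case: eqP => _ /=; ring.
  under eq_bigr do rewrite e.
  rewrite big_split /= -mulr_sumr sumr_const card_Fp.
  rewrite (bigD1 0)//= big1 => [|a /negbTE -> //].
  have -> : p%:R^-1 ^+ 2 *+ p = p%:R^-1 :> R.
    by rewrite -[LHS]mulr_natr expr2 -mulrA mulVf ?mulr1.
  rewrite addr0 mulr1.
  have : 0 <= p%:R^-1 :> R by rewrite invr_ge0.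
  lra.
move=> /andP[i_s us].
have {IHs} := IHs us.
have [y0|y0] := eqVneq (y i) 0.
  rewrite add0n; congr (_ <= _); apply: eq_bigr => a _; congr (_ ^+ 2).
  rewrite point_prob_cons// y0 subr0 -mulrDl.
  by have := w_law.2 i; rewrite big_bool /= addrC => ->; rewrite mul1r.
have [wt wf] := w_bern y0.
rewrite add1n exprS => IHs.
set f := fun a => point_prob s a - p%:R^-1 in IHs *.
rewrite (_ : l2 _ = l2 (fun a => (1 - q) * f a + q * f (a - y i))); last first.
  apply: eq_bigr => a _; congr (_ ^+ 2).
  by rewrite point_prob_cons// wt wf /f; ring.
apply: le_trans (l2_contraction y0 _) _; last first.
  by have /andP[/ltW l0 _] := l2_rate_itv; rewrite ler_wpM2l.
by rewrite /f sumrB sum_point_prob sumr_const card_Fp -[_ *+ p]mulr_natl divff// subrr.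
Qed.

Definition conc_rate : R := Num.sqrt l2_rate.

Lemma conc_rate_itv : 0 < conc_rate < 1.
Proof.
have /andP[l0 l1] := l2_rate_itv.
by rewrite /conc_rate sqrtr_gt0 l0 -sqrtr1 ltr_sqrt.
Qed.

Lemma anticoncentration a :
  `|expect w (fun r => (\sum_i y i *+ r i == a)%:R) - p%:R^-1|
    <= conc_rate ^+ #|[pred i | y i != 0]|.
Proof.
have := l2_point_prob (index_enum_uniq I).
have -> : count (fun i => y i != 0) (index_enum I) = #|[pred i | y i != 0]|.
  by rewrite -sum1_count -sum1_card; apply: eq_bigl => i; rewrite inE.
set c := #|_|; rewrite -/(point_prob _ a) => le.
rewrite -ler_sqr ?nnegrE ?exprn_ge0 ?sqrtr_ge0//.
have /andP[/ltW l0 _] := l2_rate_itv.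
rewrite -exprM mulnC exprM sqr_sqrtr// real_normK ?num_real//.
apply: le_trans le; rewrite /l2 (bigD1 a)//= lerDl.
by apply: sumr_ge0 => b _; exact: sqr_ge0.
Qed.

(** The two values of r i require the remaining sum to hit the distinct targets a and a - y i, whose
    probabilities add up to at most 1. This is what remains when a single coefficient is known to be
    nonzero, too few for equidistribution. *)
Lemma point_prob_le_max i a : y i != 0 ->
  expect w (fun r => (\sum_i y i *+ r i == a)%:R) <= Num.max q (1 - q).
Proof.
move=> yi; have [wt wf] := w_bern yi.
have perm : perm_eq (index_enum I) (i :: rem i (index_enum I)).
  exact: perm_to_rem (mem_index_enum i).
rewrite (_ : expect _ _ = point_prob (i :: rem i (index_enum I)) a); last first.
  by apply: eq_expect => f; rewrite (perm_big _ perm).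
set s := rem _ _; have is_ : i \notin s by rewrite mem_rem_uniqF ?index_enum_uniq.
rewrite point_prob_cons// wt wf.
have : point_prob s a + point_prob s (a - y i) <= 1.
  rewrite -(sum_point_prob s) (bigD1 a)//= (bigD1 (a - y i))/=; last first.
    by rewrite -subr_eq0 addrC addKr oppr_eq0.
  by rewrite addrA lerDl sumr_ge0// => b _; exact: point_prob_ge0.
have := point_prob_ge0 s a; have := point_prob_ge0 s (a - y i).
have : q <= Num.max q (1 - q) by rewrite le_max lexx.
have : 1 - q <= Num.max q (1 - q) by rewrite le_max lexx orbT.
have : 0 < q := q_gt0; have : q < 1 := q_lt1.
set m := Num.max _ _; set A := point_prob s a; set B := point_prob s _.
move=> *; nra.
Qed.

End Anticoncentration.

(** * Codimension under uniform rows: exact law and its limit *)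

Section UniformChain.
Variables (R : realType) (x : R).

(* The law of the number k of missing dimensions after s uniform rows have been
   added to a space of codimension d: a uniform row lies in that space with
   probability x ^ d. *)
Fixpoint chain (s d k : nat) : R :=
  if s is s'.+1 then x ^+ d * chain s' d k + (1 - x ^+ d) * chain s' d.-1 k
  else (d == k)%:R.

Lemma chainS s d k :
  chain s.+1 d k = x ^+ d * chain s d k + (1 - x ^+ d) * chain s d.-1 k.
Proof. by []. Qed.

Definition qprod (a b : nat) : R := \prod_(a <= i < b) (1 - x ^+ i).

Hypotheses (x_gt0 : 0 < x) (x_le_half : x <= 1 / 2).

Lemma qpow_itv n : 0 <= x ^+ n <= 1.
Proof. have x1 : x <= 1 by have := x_le_half; lra.
by rewrite exprn_ge0 ?exprn_ile1// ltW. Qed.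

Lemma qpow_le_half n : (0 < n)%N -> x ^+ n <= 1 / 2.
Proof.
case: n => // n _; rewrite exprS; have /andP[a b] := qpow_itv n.
have c := x_gt0; have d := x_le_half; nra.
Qed.

Lemma chain_itv s d k : 0 <= chain s d k <= 1.
Proof.
elim: s d => [|s IHs] d /=; first by case: (d == k); rewrite /= ?ler01 ?lexx.
have /andP[a0 a1] := IHs d; have /andP[b0 b1] := IHs d.-1.
have /andP[c0 c1] := qpow_itv d.
by apply/andP; split; nra.
Qed.

Lemma chain_small s d k : (d < k)%N -> chain s d k = 0.
Proof.
elim: s d => [|s IHs] d dk /=; first by rewrite ltn_eqF.
by rewrite !IHs ?mulr0 ?addr0//; lia.
Qed.

Lemma chain_large s d k : (s + k < d)%N -> chain s d k = 0.
Proof.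
elim: s d => [|s IHs] d dk /=; first by rewrite gtn_eqF//; lia.
by rewrite !IHs ?mulr0 ?addr0//; lia.
Qed.

Lemma qprod_recr a b : (a <= b)%N -> qprod a b.+1 = qprod a b * (1 - x ^+ b).
Proof. exact: big_nat_recr. Qed.

Lemma qprod_gt0 a b : (0 < a)%N -> 0 < qprod a b.
Proof.
move=> a0; rewrite /qprod big_nat_cond; apply: prodr_gt0 => i.
rewrite andbT => /andP[ai _]; have := qpow_le_half (leq_trans a0 ai); lra.
Qed.

Lemma qprod_le1 a b : (0 < a)%N -> qprod a b <= 1.
Proof.
move=> a0; rewrite /qprod big_nat_cond; apply: prodr_ile1 => i.
rewrite andbT => /andP[ai _]; have := qpow_le_half (leq_trans a0 ai).
by have /andP[] := qpow_itv i; lra.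
Qed.

Lemma qprod_cat a b c : (a <= b)%N -> (b <= c)%N ->
  qprod a c = qprod a b * qprod b c.
Proof. by move=> ab bc; rewrite /qprod (big_cat_nat ab bc). Qed.

(** Among a + r steps from k + r to k, r decrease the codimension and a leave it unchanged. Since
    [qprod 1 n.+1] is the q-Pochhammer symbol (x; x)_n, the sum over the positions of the a steps is
    x ^ (k a) times a Gaussian binomial coefficient, and the induction is the q-Pascal rule. *)
Lemma chain_formula (a r k : nat) :
  chain (a + r) (k + r) k =
  x ^+ (k * a) * (qprod 1 (k + r).+1 * qprod 1 (a + r).+1) /
  (qprod 1 k.+1 * qprod 1 a.+1 * qprod 1 r.+1).
Proof.
have nz n : qprod 1 n.+1 != 0 by rewrite gt_eqF// qprod_gt0.
have q1 : qprod 1 1 = 1 by rewrite /qprod big_geq.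
have qS n : qprod 1 n.+2 = qprod 1 n.+1 * (1 - x ^+ n.+1) by rewrite qprod_recr.
have u n : 1 - x ^+ n.+1 != 0.
  by rewrite gt_eqF//; have := @qpow_le_half n.+1 isT; lra.
have [s] := ubnP (a + r); elim: s a r => // s IHs a r.
case: a r => [|a] [|r]; rewrite ?add0n ?addn0.
- by move=> _; rewrite /= eqxx muln0 expr0 q1 !mulr1 mul1r divff.
- rewrite addnS /= ltnS => lt.
  rewrite chain_large; last by lia.
  have := IHs 0%N r; rewrite add0n => -> //.
  rewrite muln0 expr0 q1 !qS.
  by field; rewrite !nz !u.
- move=> /= lt; have := IHs a 0%N; rewrite !addn0 => -> //.
  (* The truncated predecessor at k = 0 is harmless: its coefficient 1 - x ^ 0 vanishes. *)
  have -> : (1 - x ^+ k) * chain a k.-1 k = 0.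
    have [->|k0] := posnP k; first by rewrite expr0 subrr mul0r.
    by rewrite chain_small ?mulr0// prednK.
  rewrite mulnS exprD q1 !qS.
  by field; rewrite !nz !u.
rewrite !addSn !addnS chainS [_.-1]/= ltnS => lt.
have := IHs a r.+1; rewrite !addnS => -> //.
have := IHs a.+1 r; rewrite !addSn => -> //.
rewrite mulnS exprD !qS.
rewrite -addSn [x ^+ (k + r).+1](_ : _ = x ^+ k * x ^+ r.+1); last first.
  by rewrite -exprD addnS.
rewrite [x ^+ (a.+1 + r).+1](_ : _ = x ^+ a.+1 * x ^+ r.+1); last first.
  by rewrite -exprD addnS.
by field; rewrite !nz !u.
Qed.

(** The surplus 2 x ^ b carries the induction: the new factor costs at most x ^ b, and 2 x ^ b - x ^
    b >= 2 x ^ (b + 1) because x <= 1/2. *)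
Lemma qprod_ge a b : (0 < a)%N -> (a <= b)%N ->
  1 - 2 * x ^+ a + 2 * x ^+ b <= qprod a b.
Proof.
move=> a0; elim: b => [|b IHb]; first by case: a a0.
rewrite leq_eqVlt => /predU1P[<-|]; first by rewrite /qprod big_geq// subrK.
rewrite ltnS => ab; rewrite qprod_recr// exprS.
have c := IHb ab; have d := qprod_le1 b a0; have := qprod_gt0 b a0.
have /andP[f g] := qpow_itv b; have := x_gt0; have := x_le_half.
by move=> h1 h2 h3; nra.
Qed.

Lemma qprod_ge_expr k : x ^+ k <= qprod 1 k.+1.
Proof.
elim: k => [|k IHk]; first by rewrite /qprod big_geq.
rewrite qprod_recr// [leLHS]exprSr ler_pM ?exprn_ge0 ?(ltW x_gt0)//.
have := @qpow_le_half k.+1 isT; have := x_le_half. lra.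
Qed.

Lemma infprod_qprod m : (0 < m)%N ->
  forall l, (m <= l)%N ->
  qprod m l * (1 - 2 * x ^+ l) <= infprod m (fun i => 1 - x ^+ i) <= qprod m l.
Proof.
move=> m0 l ml.
have decr : {homo (fun n => qprod m n) : i j / (i <= j)%N >-> j <= i}.
  move=> i j ij; have [im|mi] := leqP i m.
    by rewrite {2}/qprod big_geq// qprod_le1.
  rewrite (qprod_cat (ltnW mi) ij) ler_piMr ?(ltW (qprod_gt0 _ _))//.
  by rewrite qprod_le1// (leq_trans m0)// ltnW.
have cv : cvgn (fun n => qprod m n).
  apply: nonincreasing_is_cvgn => //; exists 0 => _ [n _ <-].
  exact/ltW/qprod_gt0.
apply/andP; split; last first.
  by apply: (limr_le cv); exists l => // n /= ln; exact: decr.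
apply: (limr_ge cv); exists l => // n /= ln.
rewrite (qprod_cat ml ln) ler_pM2l ?qprod_gt0//.
have := qprod_ge (leq_trans m0 ml) ln; have /andP[] := qpow_itv n.
lra.
Qed.

(** The error is uniform in k. For k < L the product differs from its limit by O(x ^ (L - k)), and
    the prefactor, at most x ^ (k ^ 2), restores the missing x ^ k. For k >= L the chain gives 0 and
    the limit itself is at most x ^ (k ^ 2) <= x ^ L. *)
Lemma chain_limit L k : (0 < L)%N ->
  `|chain L L.-1 k - x ^+ (k ^ 2 + k) *
     (infprod k.+2 (fun i => 1 - x ^+ i) / qprod 1 k.+1)| <= 4 * x ^+ L.
Proof.
move=> L0; set Q := infprod _ _.
have qk := qprod_gt0 k.+1 (ltn0Sn 0).
have xk0 : 0 < x ^+ k by rewrite exprn_gt0.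
have kk : (k <= k ^ 2)%N by rewrite -mulnn; case: (k) => // n; rewrite leq_pmull.
have invq : x ^+ (k ^ 2 + k) / qprod 1 k.+1 <= x ^+ (k ^ 2).
  rewrite exprD ler_pdivrMr// ler_wpM2l ?exprn_ge0 ?(ltW x_gt0)//.
  exact: qprod_ge_expr.
have invq0 : 0 <= x ^+ (k ^ 2 + k) / qprod 1 k.+1.
  by rewrite divr_ge0 ?exprn_ge0 ?ltW.
have xL := qpow_itv L.
have xmono i j : (i <= j)%N -> x ^+ j <= x ^+ i.
  by move=> ij; rewrite ler_wiXn2l ?ltW//; have := x_le_half; lra.
have Q0 l : (k.+2 <= l)%N -> 0 <= Q <= qprod k.+2 l.
  move=> kl; have /andP[a b] := infprod_qprod (ltn0Sn k.+1) kl.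
  rewrite b (le_trans _ a)// mulr_ge0 ?(ltW (qprod_gt0 _ _))//.
  by have := @qpow_le_half l (leq_trans (ltn0Sn _) kl); lra.
have [kL|Lk] := ltnP k L; last first.
  rewrite chain_small ?sub0r ?normrN; last by rewrite prednK.
  have /andP[q0 q1] := Q0 _ (leqnn _).
  have q2 : Q <= 1 by rewrite /qprod big_geq in q1.
  rewrite mulrCA ger0_norm; last exact: mulr_ge0.
  have : x ^+ (k ^ 2) <= x ^+ L by apply/xmono/(leq_trans Lk).
  have : Q * (x ^+ (k ^ 2 + k) / qprod 1 k.+1) <= x ^+ (k ^ 2 + k) / qprod 1 k.+1.
    by rewrite ler_piMl.
  by move: xL => /andP[? _]; lra.
have [r Lr] : exists r, (L = (k + r).+1)%N by exists (L - k.+1)%N; rewrite -addSn subnKC.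
have -> : chain L L.-1 k = chain (k.+1 + r) (k + r) k by rewrite Lr addSn.
rewrite chain_formula mulnS mulnn addnC addSn -Lr.
have -> : qprod 1 L.+1 = qprod 1 k.+2 * qprod k.+2 L.+1.
  by rewrite (@qprod_cat 1 k.+2).
have -> : qprod 1 L = qprod 1 r.+1 * qprod r.+1 L.
  by rewrite (@qprod_cat 1 r.+1)// Lr ltnS leq_addl.
set A := qprod k.+2 L.+1; set B := qprod r.+1 L.
rewrite (_ : _ - _ = x ^+ (k ^ 2 + k) / qprod 1 k.+1 * (A * B - Q)); last first.
  by field; rewrite !gt_eqF ?qprod_gt0.
have kL2 : (k.+2 <= L.+1)%N by [].
have /andP[] := infprod_qprod (ltn0Sn k.+1) kL2; rewrite -/Q -/A => h1 h2.
have A1 : A <= 1 by exact: qprod_le1.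
have A0 : 0 < A by exact: qprod_gt0.
have B1 : B <= 1 by exact: qprod_le1.
have rL : (r.+1 <= L)%N by rewrite Lr ltnS leq_addl.
have Bge : 1 - 2 * x ^+ r.+1 <= B.
  by have := qprod_ge (ltn0Sn r) rL; move: xL => /andP[? ?]; rewrite -/B; lra.
have xr : x ^+ L.+1 <= x ^+ r.+1 by apply/xmono/leqW.
have AB : `|A * B - Q| <= 4 * x ^+ r.+1.
  have AB1 : A * B <= A by rewrite ler_piMr// ltW.
  have AB2 : A * (1 - B) <= 2 * x ^+ r.+1.
    apply: le_trans (_ : 1 - B <= _); last by lra.
    by rewrite ler_piMl//; lra.
  have AB3 : A * (2 * x ^+ L.+1) <= 2 * x ^+ L.+1.
    by rewrite ler_piMl// mulr_ge0// exprn_ge0// ltW.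
  by rewrite ler_norml; apply/andP; split; lra.
rewrite normrM (ger0_norm invq0).
apply: le_trans (ler_wpM2l invq0 AB) _.
rewrite mulrCA ler_wpM2l//.
apply: le_trans (ler_wpM2r _ invq) _; first by rewrite exprn_ge0// ltW.
by rewrite -exprD; apply: xmono; rewrite Lr -addnS leq_add2r.
Qed.

End UniformChain.

Lemma limit_law_chain (R : realType) (p k L : nat) : prime p -> (0 < L)%N ->
  `|chain (p%:R^-1 : R) L L.-1 k - limit_law R p k| <= 4 * p%:R^-1 ^+ L.
Proof.
move=> p_prime L0; have p2 : 2 <= p%:R :> R by rewrite ler_nat prime_gt1.
have x0 : 0 < p%:R^-1 :> R by rewrite invr_gt0; lra.
have x1 : p%:R^-1 <= 1 / 2 :> R by rewrite div1r lef_pV2 ?posrE; lra.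
have := chain_limit x0 x1 k L0; congr (_ <= _); congr `|_ - _|.
rewrite /limit_law /qprod -exprVn; congr (_ * (_ / _)).
  by congr infprod; apply: funext => i; rewrite exprVn.
by apply: eq_bigr => i _; rewrite exprVn.
Qed.

(** * Null vectors of the exposed rows in the random bipartite model *)

Lemma card_row_kernel (F : finFieldType) (m k : nat) (B : 'M[F]_(m, k)) :
  #|[set y : 'rV[F]_m | y *m B == 0]| = (#|F| ^ (m - \rank B))%N.
Proof.
pose f (z : 'rV[F]_(\rank (kermx B))) := z *m row_base (kermx B).
have f_inj : injective f by apply: row_free_inj; exact: row_base_free.
rewrite -[RHS](_ : #|[set f z | z in [set: 'rV[F]_(\rank (kermx B))]]| = _); last first.
  by rewrite (card_imset _ f_inj) cardsT card_mx mul1n mxrank_ker.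
apply: eq_card => y; rewrite inE.
apply/eqP/imsetP => [yB|[z _ ->]]; last first.
  apply/eqP; rewrite -sub_kermx; apply: submx_trans (submxMl _ _) _.
  by rewrite eq_row_base.
have : (y <= row_base (kermx B))%MS by rewrite eq_row_base sub_kermx yB.
by case/submxP => z ->; exists z.
Qed.

Section BipartiteModel.
Variables (p : nat) (p_prime : prime p) (n N : nat).
Local Notation m := (n + N)%N.
Local Notation row := {ffun 'I_m -> bool}.
Local Notation config := {ffun 'I_m -> {ffun 'I_m -> bool}}.
Local Notation vec := {ffun 'I_m -> 'F_p}.

Definition adj (u v : 'I_m) : bool := ((u < n) != (v < n))%N.

(* [jump x u v] is the coefficient of the indicator of the arc u -> v in the
   scalar product of row u of the Laplacian with x. *)
Definition jump (x : vec) (u v : 'I_m) : 'F_p := if adj u v then x v - x u else 0.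

Definition kills (u : 'I_m) (r : row) (x : vec) : bool :=
  \sum_v jump x u v *+ r v == 0.

Definition null_vecs (i : nat) (w : config) : {set vec} :=
  [set x : vec | [forall u : 'I_m, (u < i)%N ==> kills u (w u) x]].

Definition graph_of (w : config) : digraph m :=
  [set e : 'I_m * 'I_m | adj e.1 e.2 && w e.1 e.2].

Definition partial_mx (i : nat) (w : config) : 'M['F_p]_m :=
  \matrix_(u, v) if (u < i)%N then mx_mod p (laplacian (graph_of w)) u v else 0.

Lemma laplacian_row w u (x : vec) :
  \sum_v mx_mod p (laplacian (graph_of w)) u v * x v =
  \sum_v jump x u v *+ w u v.
Proof.
have jump_diag : jump x u u = 0 by rewrite /jump /adj eqxx.
rewrite (bigD1 u)//= [RHS](bigD1 u)//= jump_diag mul0rn add0r.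
rewrite !mxE eqxx rmorphN rmorph_sum /= mulNr mulr_suml -sumrN -big_split /=.
apply: eq_bigr => v vu; rewrite !mxE eq_sym (negbTE vu) !inE /= /jump.
by case: (adj u v); case: (w u v);
  rewrite ?mulr0n ?mulr1n ?mul1r ?mul0r ?oppr0 ?addr0// addrC.
Qed.

Lemma partial_mx_kernel i w (x : vec) :
  (x \in null_vecs i w) = ((\row_v x v) *m (partial_mx i w)^T == 0).
Proof.
have E u : ((\row_v x v) *m (partial_mx i w)^T) 0 u =
    if (u < i)%N then \sum_v jump x u v *+ w u v else 0.
  rewrite mxE -laplacian_row; case: ifP => ui; last first.
    by apply: big1 => v _; rewrite [_^T _ _]mxE [partial_mx _ _ _ _]mxE ui mulr0.
  apply: eq_bigr => v _.
  by rewrite [_^T _ _]mxE [partial_mx _ _ _ _]mxE [(\row__ _) _ _]mxE ui mulrC.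
rewrite inE; apply/forallP/eqP => [K|/rowP K u].
  apply/rowP => u; rewrite E mxE; case: ifP => // ui.
  by have /implyP/(_ ui)/eqP := K u.
by apply/implyP => ui; have := K u; rewrite E ui mxE => /eqP.
Qed.

Lemma card_kernel i w : #|null_vecs i w| = (p ^ corank (partial_mx i w))%N.
Proof.
have := card_row_kernel (partial_mx i w)^T.
rewrite mxrank_tr card_Fp// => <-.
pose f (x : vec) : 'rV['F_p]_m := \row_v x v.
have f_bij : bijective f.
  exists (fun y : 'rV['F_p]_m => [ffun v => y 0 v]) => [x|y].
    by apply/ffunP => v; rewrite ffunE mxE.
  by apply/rowP => v; rewrite mxE ffunE.
rewrite -(on_card_preimset (f := f)); last exact: onW_bij.
by apply: eq_card => x; rewrite partial_mx_kernel !inE.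
Qed.

Lemma kernelS i w : null_vecs i.+1 w \subset null_vecs i w.
Proof.
apply/fintype.subsetP => x; rewrite !inE => /forallP K; apply/forallP => u.
by apply/implyP => ui; have /implyP := K u; apply; rewrite ltnS ltnW.
Qed.

Lemma mem_kernelS (i : 'I_m) w x :
  (x \in null_vecs i.+1 w) = (x \in null_vecs i w) && kills i (w i) x.
Proof.
apply/idP/andP => [xK|[]].
  split; first exact: (fintype.subsetP (kernelS i w)).
  by move: xK; rewrite inE => /forallP/(_ i)/implyP; apply.
rewrite !inE => /forallP K Ki; apply/forallP => u; apply/implyP.
rewrite ltnS leq_eqVlt => /predU1P[/val_inj -> //|ui].
by have /implyP := K u; apply.
Qed.

Lemma corank_partial_le i w :
  (corank (partial_mx i.+1 w) <= corank (partial_mx i w))%N.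
Proof.
rewrite -(@leq_exp2l p) ?prime_gt1// -!card_kernel.
exact: subset_leq_card (kernelS i w).
Qed.

(** Exposing a row adds a matrix of rank at most one; beyond the last row nothing changes. *)
Lemma corank_partial_ge i w : 
  (corank (partial_mx i w) <= (corank (partial_mx i.+1 w)).+1)%N.
Proof.
have [im|mi] := ltnP i m; last first.
  rewrite leqW// /corank (_ : partial_mx i.+1 w = partial_mx i w)//.
  by apply/matrixP => u v; rewrite !mxE ltnS ltnW ?(leq_trans _ mi)// (leq_trans _ mi).
pose M := mx_mod p (laplacian (graph_of w)).
pose c : 'cV['F_p]_m := \col_u (u == Ordinal im)%:R.
have E : partial_mx i.+1 w = partial_mx i w + c *m matrix.row (Ordinal im) M.
  apply/matrixP => u v; rewrite [LHS]mxE [RHS]mxE [partial_mx i w u v]mxE.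
  rewrite [(c *m _) u v]mxE big_ord1 !mxE ltnS leq_eqVlt.
  have [ui|ui] := eqVneq (val u) i.
    have -> : u = Ordinal im by apply: val_inj.
    by rewrite /= ltnn eqxx mul1r add0r.
  rewrite (_ : (u == Ordinal im) = false) ?mul0r ?addr0//.
  by apply/negbTE; apply: contra_neq ui => ->.
have : (\rank (partial_mx i.+1 w) <= (\rank (partial_mx i w)).+1)%N.
  rewrite E -[leqRHS]addn1; apply: leq_trans (mxrank_add _ _) _.
  by rewrite leq_add2l mulmx_max_rank.
rewrite /corank; lia.
Qed.

Lemma corank_partial0 w : corank (partial_mx 0 w) = m.
Proof.
rewrite /corank (_ : partial_mx 0 w = 0) ?mxrank0 ?subn0//.
by apply/matrixP => u v; rewrite !mxE.
Qed.

(** This deterministic lower bound is what lets a first moment control the dimension. *)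
Lemma corank_partial_geq i w : (m - i <= corank (partial_mx i w))%N.
Proof.
elim: i => [|i IHi]; first by rewrite corank_partial0 subn0.
have := corank_partial_ge i w; lia.
Qed.

Lemma corank_partial_full w :
  corank (partial_mx m w) = corank (mx_mod p (laplacian (graph_of w))).
Proof.
by congr corank; apply/matrixP => u v; rewrite [LHS]mxE ltn_ord.
Qed.

Variables (R : realType) (q : R) (q_gt0 : 0 < q) (q_lt1 : q < 1).

Definition arc_law (u v : 'I_m) (b : bool) : R :=
  if adj u v then (if b then q else 1 - q) else (~~ b)%:R.

(** A product weight again, so [expect (arc_law u)] unfolds to a sum against [row_law u]: the same
    operator serves the entries of a row and the rows of the matrix. *)
Definition row_law (u : 'I_m) (r : row) : R := \prod_v arc_law u v (r v).

Lemma arc_lawP u : is_law (arc_law u).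
Proof.
split=> [v b|v]; rewrite /arc_law.
  case: (adj u v) => //; case: b; rewrite ?ler0n//; first exact: ltW.
  by rewrite subr_ge0 ltW.
by rewrite big_bool /=; case: (adj u v); rewrite ?add0r// addrC subrK.
Qed.

Lemma row_lawP : is_law row_law.
Proof.
split=> [u r|u]; first by apply: prodr_ge0 => v _; exact: (arc_lawP u).1.
have := expect_cst 1 (arc_lawP u); rewrite /expect.
by under eq_bigr do rewrite mulr1.
Qed.

(** Configurations may switch on forbidden pairs, which makes them correspond bijectively to all
    digraphs; both weights vanish when a forbidden pair is on, and otherwise [graph_of] removes
    nothing. *)
Lemma bip_prob_expect (A : pred (digraph m)) :
  bip_prob q A = expect row_law (fun w => (A (graph_of w))%:R).
Proof.
rewrite /bip_prob big_mkcond /expect /=.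
pose g (w : config) : digraph m := [set e : 'I_m * 'I_m | w e.1 e.2].
have g_bij : bijective g.
  exists (fun G : digraph m => [ffun u => [ffun v => (u, v) \in G]]) => [w|G].
    by apply/ffunP => u; apply/ffunP => v; rewrite !ffunE inE.
  by apply/setP => -[u v]; rewrite inE !ffunE.
rewrite (reindex g) /=; last exact: onW_bij.
apply: eq_bigr => w _; rewrite /bip_weight.
have [sub|nsub] := boolP (g w \subset bip_arcs n N).
  have -> : graph_of w = g w.
    apply/setP => -[u v]; rewrite !inE /=.
    case wuv: (w u v); rewrite ?andbF ?andbT//.
    by have /fintype.subsetP/(_ (u, v)) := sub; rewrite !inE /= wuv; apply.
  suff -> : \prod_u row_law u (w u) =
      \prod_(e in bip_arcs n N) (if e \in g w then q else 1 - q).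
    by case: (A _); rewrite ?mulr1 ?mulr0.
  rewrite /row_law (pair_bigA _ (fun u v => arc_law u v (w u v)))/=.
  rewrite (bigID (fun e => e \in bip_arcs n N))/= [X in _ * X]big1 ?mulr1.
    by apply: eq_bigr => -[u v] /=; rewrite !inE /= /arc_law /adj => ->.
  move=> -[u v] /=; rewrite inE /= => nadj.
  rewrite /arc_law /adj (negbTE nadj).
  case wuv: (w u v) => //.
  by have /fintype.subsetP/(_ (u, v)) := sub; rewrite !inE /= wuv (negbTE nadj) => /(_ isT).
have /fintype.subsetPn[[u v]] := nsub; rewrite !inE /= => wuv nadj.
rewrite (bigD1 u)//= /row_law (bigD1 v)//= /arc_law /adj (negbTE nadj) wuv.
by rewrite /= !mul0r; case: ifP.
Qed.

Definition kill_prob (u : 'I_m) (x : vec) : R :=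
  expect (arc_law u) (fun r => (kills u r x)%:R).

Lemma kill_prob_ge0 u x : 0 <= kill_prob u x.
Proof. by apply: expect_ge0 => [|f]; [exact: arc_lawP|exact: ler0n]. Qed.

Lemma kill_prob_le1 u x : kill_prob u x <= 1.
Proof.
rewrite -[leRHS](expect_cst 1 (arc_lawP u)).
by apply: expect_le => [|r]; [exact: arc_lawP|case: kills].
Qed.

Lemma arc_law_bern x u v :
  jump x u v != 0 -> arc_law u v true = q /\ arc_law u v false = 1 - q.
Proof. by rewrite /jump /arc_law; case: (adj u v); rewrite ?eqxx. Qed.

Lemma kill_prob_conc u x :
  `|kill_prob u x - p%:R^-1| <= conc_rate p q ^+ #|[pred v | jump x u v != 0]|.
Proof.
exact: (anticoncentration p_prime q_gt0 q_lt1 (arc_lawP u) (@arc_law_bern x u)).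
Qed.

Lemma kill_prob_le_max u v x : jump x u v != 0 ->
  kill_prob u x <= Num.max q (1 - q).
Proof.
move=> xuv.
exact: (point_prob_le_max q_gt0 q_lt1 (arc_lawP u) (@arc_law_bern x u) _ xuv).
Qed.

Lemma expect_kill_prod (A : pred 'I_m) (x : vec) :
  expect row_law (fun w => \prod_(u | A u) (kills u (w u) x)%:R) =
  \prod_(u | A u) kill_prob u x.
Proof.
rewrite (@eq_expect _ _ _ _ _
  (fun w => \prod_u (if A u then (kills u (w u) x)%:R else 1))); last first.
  by move=> w; rewrite -big_mkcond.
rewrite (expect_prod row_law (fun u r => if A u then (kills u r x)%:R else 1)).
rewrite [RHS]big_mkcond; apply: eq_bigr => u _; case: (A u) => //.
by under eq_bigr do rewrite mulr1; exact: row_lawP.2.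
Qed.

Lemma mem_kernel_prod i w x :
  (x \in null_vecs i w)%:R = \prod_(u : 'I_m | (u < i)%N) (kills u (w u) x)%:R :> R.
Proof.
rewrite inE; case: (boolP [forall u : 'I_m, (u < i)%N ==> kills u (w u) x])
  => [/forallP K|/forallPn[u]].
  by rewrite big1// => u ui; have /implyP/(_ ui) -> := K u.
by rewrite negb_imply => /andP[ui Ku]; rewrite (bigD1 u)//= (negbTE Ku) mul0r.
Qed.

Lemma expect_mem_kernel i x :
  expect row_law (fun w => (x \in null_vecs i w)%:R) =
  \prod_(u : 'I_m | (u < i)%N) kill_prob u x.
Proof.
by rewrite -expect_kill_prod; apply: eq_expect => w; rewrite mem_kernel_prod.
Qed.

End BipartiteModel.

(** * Comparison of the last rows with uniform rows *)

Section LastRows.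
Variables (p : nat) (p_prime : prime p) (n N : nat).
Local Notation m := (n + N)%N.
Local Notation row := {ffun 'I_m -> bool}.
Local Notation config := {ffun 'I_m -> {ffun 'I_m -> bool}}.
Local Notation vec := {ffun 'I_m -> 'F_p}.
Variables (R : realType) (q : R) (q_gt0 : 0 < q) (q_lt1 : q < 1).

Definition cst_vec (a : 'F_p) : vec := [ffun=> a].

Definition is_cst (x : vec) : bool := x \in codom cst_vec.

Lemma jump_cst u v a : jump (cst_vec a) u v = 0.
Proof. by rewrite /jump !ffunE subrr if_same. Qed.

Lemma kills_cst u (r : row) a : kills u r (cst_vec a).
Proof. by rewrite /kills big1// => v _; rewrite jump_cst mul0rn. Qed.

Lemma cst_kernel i (w : config) a : cst_vec a \in null_vecs p i w.
Proof. by rewrite inE; apply/forallP => u; rewrite kills_cst implybT. Qed.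

Lemma kill_prob_cst u a : kill_prob q u (cst_vec a) = 1.
Proof.
rewrite /kill_prob (@eq_expect _ _ _ _ _ (fun=> 1)); last first.
  by move=> r; rewrite kills_cst.
by rewrite expect_cst//; exact: arc_lawP.
Qed.

Lemma card_is_cst : (0 < m)%N -> #|is_cst| = p.
Proof.
move=> m0; rewrite /is_cst -[RHS](card_Fp p_prime) -(card_codom (f := cst_vec))//.
by move=> a b /ffunP/(_ (Ordinal m0)); rewrite !ffunE.
Qed.

Lemma kernel_update (i : 'I_m) j (w : config) r : (j <= i)%N ->
  null_vecs p j (update w i r) = null_vecs p j w.
Proof.
move=> ji; apply/setP => x; rewrite !inE; apply: eq_forallb => u.
case: ltnP => //= uj; rewrite ffunE; case: eqP => // ui.
by rewrite ui ltnNge ji in uj.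
Qed.

Lemma corank_update (i : 'I_m) j (w : config) r : (j <= i)%N ->
  corank (partial_mx p j (update w i r)) = corank (partial_mx p j w).
Proof.
move=> ji; apply: (expnI (prime_gt1 p_prime)).
by rewrite -!(card_kernel p_prime) kernel_update.
Qed.

Lemma corank_partial_gt0 i (w : config) : (0 < m)%N ->
  (0 < corank (partial_mx p i w))%N.
Proof.
move=> m0; suff : (p ^ 0 < p ^ corank (partial_mx p i w))%N.
  by rewrite ltn_exp2l ?prime_gt1.
rewrite expn0 -(card_kernel p_prime).
apply: leq_trans (_ : #|is_cst| <= _)%N; first by rewrite card_is_cst ?prime_gt1.
by apply/subset_leq_card/fintype.subsetP => _ /codomP[a ->]; exact: cst_kernel.
Qed.

Variables (close : pred vec) (i1 : nat) (eps : R).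
Hypothesis close_prob : forall (u : 'I_m) x, (i1 <= u)%N -> close x ->
  `|kill_prob q u x - p%:R^-1| <= eps.

(** Stated at time [i1] only: the null spaces decrease, so the property persists. *)
Definition tame (w : config) : bool :=
  [forall x in null_vecs p i1 w, is_cst x || close x].

Definition stay_prob (i : 'I_m) (w : config) : R :=
  expect (arc_law q i) (fun r =>
    (corank (partial_mx p i.+1 (update w i r)) == corank (partial_mx p i w))%:R).

Lemma kernel_tame (i : nat) w x : tame w -> (i1 <= i)%N -> x \in null_vecs p i w ->
  is_cst x || close x.
Proof.
move=> /forallP tw ii xK; have /implyP := tw x; apply.
by move: xK; rewrite !inE => /forallP K; apply/forallP => u; apply/implyP => ui;
  have /implyP := K u; apply; exact: leq_trans ii.
Qed.

Hypothesis eps_ge0 : 0 <= eps.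

(* E |null_vecs (i+1)| can be computed in two ways: through [stay_prob], since the
   null_vecs either is kept or shrinks by a factor p, and by summing the
   probabilities that row i kills each of the vectors of the null_vecs. *)
Lemma stay_prob_close (i : 'I_m) w : (i1 <= i)%N -> tame w ->
  `|stay_prob i w - p%:R^-1 ^+ (corank (partial_mx p i w)).-1| <= 2 * eps.
Proof.
move=> ii tw; have m0 : (0 < m)%N by apply: leq_ltn_trans (ltn_ord i).
have p2 : 2 <= p%:R :> R by rewrite ler_nat prime_gt1.
have p0 : p%:R != 0 :> R by rewrite gt_eqF//; lra.
have := corank_partial_gt0 i w m0.
case Ec: (corank _) => [//|c] _ /=; set P : R := p%:R ^+ c.
have P1 : 1 <= P by rewrite exprn_ege1//; lra.
have cardK : #|null_vecs p i w|%:R = p%:R * P.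
  by rewrite (card_kernel p_prime) Ec natrX exprS.
have E1 : expect (arc_law q i) (fun r => #|null_vecs p i.+1 (update w i r)|%:R) =
    P * (1 + (p%:R - 1) * stay_prob i w).
  rewrite mulrDr mulr1 mulrA -expectZ.
  rewrite -[X in _ = X + _](expect_cst P (arc_lawP q_gt0 q_lt1 i)) -expectD.
  apply: eq_expect => r; rewrite (card_kernel p_prime).
  have := corank_partial_le p_prime i (update w i r).
  have := corank_partial_ge p_prime i (update w i r).
  rewrite (corank_update (j := i))// Ec.
  set c' := corank _; rewrite ltnS leq_eqVlt => /predU1P[<-|cc'].
    by move=> _; rewrite ltn_eqF// mulr0 addr0 natrX.
  move=> c'c; have -> : c' = c.+1 by apply/eqP; rewrite eqn_leq c'c cc'.
  by rewrite eqxx natrX exprS -/P mulr1n; ring.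
have E2 : expect (arc_law q i) (fun r => #|null_vecs p i.+1 (update w i r)|%:R) =
    \sum_(x in null_vecs p i w) kill_prob q i x.
  rewrite -expect_sum; apply: eq_expect => r.
  rewrite -sum1_card natr_sum.
  rewrite (eq_bigl (fun x => (x \in null_vecs p i w) && kills i r x)); last first.
    move=> x; rewrite mem_kernelS kernel_update// ffunE eqxx//.
  by rewrite big_mkcondr; apply: eq_bigr => x _; case: kills.
have E3 : \sum_(x in null_vecs p i w) (kill_prob q i x - p%:R^-1) =
    P * (1 + (p%:R - 1) * stay_prob i w) - P.
  by rewrite sumrB -E2 E1 sumr_const -[X in _ - X]mulr_natl cardK; field.
have E4 : `|\sum_(x in null_vecs p i w) (kill_prob q i x - p%:R^-1) - (p%:R - 1)|
    <= p%:R * P * eps.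
  rewrite (bigID is_cst)/=.
  rewrite [X in X + _ - _](_ : _ = p%:R - 1); last first.
    rewrite (eq_bigl (fun x => x \in is_cst)); last first.
      move=> x; rewrite andbC [RHS]unfold_in; case xc : (is_cst x) => //=.
      by move: xc => /codomP[a ->]; rewrite codom_f cst_kernel.
    rewrite (eq_bigr (fun=> 1 - p%:R^-1)); last first.
      by move=> _ /codomP[a ->]; rewrite kill_prob_cst.
    by rewrite sumr_const card_is_cst// -[LHS]mulr_natl; field.
  rewrite addrC addKr; apply: le_trans (ler_norm_sum _ _ _) _.
  apply: le_trans (_ : \sum_(x in null_vecs p i w) eps <= _); last first.
    by rewrite sumr_const -[leLHS]mulr_natl cardK.
  rewrite [leRHS](bigID is_cst)/=; rewrite -[leLHS]add0r lerD//.
    by apply: sumr_ge0.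
  apply: ler_sum => x /andP[xK xc]; apply: close_prob => //.
  by have := kernel_tame tw ii xK; rewrite (negbTE xc).
rewrite E3 in E4.
have xP : p%:R^-1 ^+ c * P = 1 by rewrite /P exprVn mulVf// expf_neq0.
set y := p%:R^-1 ^+ c in xP *; set t := stay_prob i w in E4 *.
(* Dividing by (p - 1) P leaves p / (p - 1) <= 2, the constant of the statement. *)
have {E4} : (p%:R - 1) * P * `|t - y| <= p%:R * P * eps.
  rewrite -[X in X * `|_|]ger0_norm -?normrM; last by rewrite mulr_ge0; lra.
  rewrite (_ : (p%:R - 1) * P * (t - y) =
    P * (1 + (p%:R - 1) * t) - P - (p%:R - 1) * (y * P)); last by ring.
  by rewrite xP mulr1.
have := normr_ge0 (t - y); have := eps_ge0; move: `|_| => z e0 z0.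
rewrite mulrAC [leRHS]mulrAC ler_pM2r; last by lra.
by move=> h; nra.
Qed.

(** Hybrid law: the first i rows are the true ones and the remaining ones are replaced by uniform
    rows. The predecessor accounts for the line of constant vectors, which is never lost. *)
Definition step_law (k i : nat) (w : config) : R :=
  chain (p%:R^-1 : R) (m - i) (corank (partial_mx p i w)).-1 k.

Definition success (w : config) : bool :=
  tame w && (corank (partial_mx p i1 w) == (m - i1)%N).

Lemma success_update (i : 'I_m) w r : (i1 <= i)%N ->
  success (update w i r) = success w.
Proof. by move=> ii; rewrite /success /tame corank_update// kernel_update. Qed.

(** Resampling row i alone leaves [success] unchanged, as it depends on earlier rows. The change is
    then the error of [stay_prob] times a difference of two probabilities. *)
Lemma step_law_close k (i : 'I_m) : (i1 <= i)%N ->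
  `|expect (row_law q) (fun w => (success w)%:R * step_law k i.+1 w) -
    expect (row_law q) (fun w => (success w)%:R * step_law k i w)| <= 2 * eps.
Proof.
move=> ii; have m0 : (0 < m)%N by apply: leq_ltn_trans (ltn_ord i).
have p2 : 2 <= p%:R :> R by rewrite ler_nat prime_gt1.
have x0 : 0 < p%:R^-1 :> R by rewrite invr_gt0; lra.
have x1 : p%:R^-1 <= 1 / 2 :> R by rewrite div1r lef_pV2 ?posrE; lra.
rewrite -expectB (expect_resample i _ (row_lawP n N q_gt0 q_lt1)).
apply: le_trans (ler_norm_expect _ (row_lawP n N q_gt0 q_lt1)) _.
rewrite -[leRHS](expect_cst _ (row_lawP n N q_gt0 q_lt1)).
apply: (expect_le (row_lawP n N q_gt0 q_lt1)) => w.
have [sw|nsw] := boolP (success w); last first.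
  rewrite big1 ?normr0 ?mulr_ge0// => r _.
  by rewrite success_update// (negbTE nsw) !mul0r subrr mulr0.
set c := corank (partial_mx p i w).
set s := (m - i.+1)%N.
pose x : R := p%:R^-1.
have es : (m - i = s.+1)%N by rewrite -subSn.
rewrite (_ : \sum_r _ = (stay_prob i w - x ^+ c.-1) *
    (chain x s c.-1 k - chain x s c.-2 k)); last first.
  rewrite mulrC -[x ^+ c.-1](expect_cst _ (arc_lawP q_gt0 q_lt1 i)) -expectB.
  rewrite -expectZ; apply: eq_bigr => r _; congr (_ * _).
  rewrite success_update// sw !mul1r /step_law es -/s chainS.
  rewrite (corank_update (j := i))// -/c.
  have := corank_partial_le p_prime i (update w i r).
  have := corank_partial_ge p_prime i (update w i r).
  rewrite (corank_update (j := i))// -/c -/x.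
  set c' := corank _ => cc' c'c.
  have [-> /=|ne] := eqVneq c' c.
    by move: (chain _ _ _ _) (chain _ _ _ _) (_ ^+ _) => A B y; ring.
  have -> : c' = c.-1.
    by move: cc'; rewrite leq_eqVlt ltnS => /predU1P[->//|]; case: ltngtP ne c'c.
  by move: (chain _ _ _ _) (chain _ _ _ _) (_ ^+ _) => A B y /=; ring.
rewrite normrM; have /andP[tw _] := sw.
have := stay_prob_close ii tw; rewrite -/c -/x => st.
apply: le_trans (_ : `|stay_prob i w - x ^+ c.-1| * 1 <= _); last by rewrite mulr1.
rewrite ler_wpM2l//; have := chain_itv x0 x1 s c.-1 k.
have := chain_itv x0 x1 s c.-2 k; rewrite -/x => /andP[a b] /andP[a' b'].
by rewrite ler_norml; apply/andP; split; lra.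
Qed.

Lemma final_corank_chain k : (i1 <= m)%N -> (0 < m)%N ->
  `|expect (row_law q) (fun w : config => (corank (partial_mx p m w) == k.+1)%:R) -
    chain (p%:R^-1 : R) (m - i1) (m - i1).-1 k|
  <= expect (row_law q) (fun w : config => (~~ success w)%:R) + (m - i1)%:R * (2 * eps).
Proof.
move=> i1m m0.
have lawP := row_lawP n N q_gt0 q_lt1.
have p2 : 2 <= p%:R :> R by rewrite ler_nat prime_gt1.
have x0 : 0 < p%:R^-1 :> R by rewrite invr_gt0; lra.
have x1 : p%:R^-1 <= 1 / 2 :> R by rewrite div1r lef_pV2 ?posrE; lra.
set x : R := p%:R^-1 in x0 x1 *.
set f := chain x _ _ k.
have tele j : (i1 + j <= m)%N ->
    `|expect (row_law q) (fun w : config => (success w)%:R * step_law k (i1 + j) w) -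
      expect (row_law q) (fun w : config => (success w)%:R * step_law k i1 w)|
    <= j%:R * (2 * eps).
  elim: j => [|j IHj] jm; first by rewrite addn0 subrr normr0 mul0r.
  rewrite addnS in jm *; have ii : (i1 <= Ordinal jm)%N by exact: leq_addr.
  have := step_law_close k ii; rewrite /= => step.
  rewrite mulrSr mulrDl mul1r.
  rewrite -[X in `|X|](subrKA (expect (row_law q)
    (fun w : config => (success w)%:R * step_law k (i1 + j) w))) addrC.
  by apply: le_trans (ler_normD _ _) _; rewrite lerD// IHj// ltnW.
have {tele} := tele (m - i1)%N; rewrite subnKC// => /(_ (leqnn _)).
rewrite (@eq_expect _ _ _ _ (fun w : config => _ * step_law k i1 w)
  (fun w : config => (success w)%:R * f)); last first.
  move=> w; case sw: (success w); rewrite ?mul0r// !mul1r.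
  by move: sw => /andP[_ /eqP e]; rewrite /step_law e.
rewrite (@eq_expect _ _ _ _ (fun w : config => _ * step_law k m w)
  (fun w : config => (corank (partial_mx p m w) == k.+1)%:R -
    (~~ success w)%:R * (corank (partial_mx p m w) == k.+1)%:R)); last first.
  move=> w; rewrite /step_law subnn /= -(eqSS _.-1) prednK; last first.
    exact: corank_partial_gt0.
  by case: (success w); rewrite ?mul1r ?mul0r ?subr0 ?subrr.
rewrite (@eq_expect _ _ _ _ (fun w : config => _ * f)
  (fun w : config => f - (~~ success w)%:R * f)); last first.
  by move=> w; case: (success w); rewrite ?mul1r ?mul0r ?subr0 ?subrr.
rewrite !expectB expect_cst//.
set A := expect _ (fun w : config => (corank _ == _)%:R).
set B := expect _ (fun w : config => _ * (corank _ == _)%:R).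
set C := expect _ (fun w : config => _ * f).
set D := expect _ (fun w : config => (~~ success w)%:R).
have /andP[f0 f1] : 0 <= f <= 1 by exact: chain_itv.
(* [B] and [C] both lie between 0 and [D], so their difference costs the failure probability only
   once. *)
have B0 : 0 <= B by apply: expect_ge0 => // w; rewrite mulr_ge0.
have C0 : 0 <= C by apply: expect_ge0 => // w; rewrite mulr_ge0.
have BD : B <= D.
  by apply: expect_le => // w; rewrite ler_piMr// lern1 leq_b1.
have CD : C <= D by apply: expect_le => // w; rewrite ler_piMr.
rewrite !ler_norml => /andP[h1 h2]; apply/andP; split; lra.
Qed.

End LastRows.

(** * First moment of the number of null vectors *)

Section FirstMoment.
Variables (p : nat) (p_prime : prime p) (n N : nat).
Local Notation m := (n + N)%N.
Local Notation row := {ffun 'I_m -> bool}.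
Local Notation config := {ffun 'I_m -> {ffun 'I_m -> bool}}.
Local Notation vec := {ffun 'I_m -> 'F_p}.
Variables (R : realType) (q : R) (q_gt0 : 0 < q) (q_lt1 : q < 1).
Variables (D i1 : nat) (s t eps rho kappa : R).
Hypotheses (D_ge2 : (2 <= D)%N) (n_le_pN : (n <= p * N)%N)
  (n_le_i1 : (n <= i1)%N) (i1_le_m : (i1 <= m)%N)
  (s_ge1 : 1 <= s) (t_gt0 : 0 < t) (sDt : 1 <= s ^+ D * t)
  (kappa_ge0 : 0 <= kappa) (eps_ge0 : 0 <= eps) (rho_eps : p%:R^-1 + eps <= rho).
Hypothesis kill_prob_eps : forall (u : 'I_m) (x : vec),
  (n <= p * D * #|[pred v | jump x u v != 0%R]|)%N ->
  `|kill_prob q u x - p%:R^-1| <= eps.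
Hypothesis kill_prob_kappa : forall (u v : 'I_m) (x : vec),
  jump x u v != 0 -> kill_prob q u x <= kappa.

Definition deviation1 (c : 'F_p) (x : vec) : nat :=
  #|[pred v : 'I_m | (v < n)%N && (x v != c)]|.
Definition deviation2 (c : 'F_p) (x : vec) : nat :=
  #|[pred v : 'I_m | (n <= v)%N && (x v != c)]|.

(** Row u of V_2 meets [deviation1 (x u) x] jumps; quantifying over every constant makes the
    estimate independent of the value x u. *)
Definition spread1 (x : vec) : bool := [forall c, (n <= D * deviation1 c x)%N].
Definition spread2 (x : vec) : bool := [forall c, (N <= D * deviation2 c x)%N].

Lemma card_jump2 (u : 'I_m) (x : vec) : (n <= u)%N ->
  #|[pred v | jump x u v != 0%R]| = deviation1 (x u) x.
Proof.
move=> nu; apply: eq_card => v; rewrite !inE /jump /adj ltnNge nu /=.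
by case: ltnP => _ /=; rewrite ?eqxx// subr_eq0.
Qed.

Lemma card_jump1 (u : 'I_m) (x : vec) : (u < n)%N ->
  #|[pred v | jump x u v != 0%R]| = deviation2 (x u) x.
Proof.
move=> un; apply: eq_card => v; rewrite !inE /jump /adj un /=.
by case: ltnP => _ /=; rewrite ?eqxx// subr_eq0.
Qed.

Lemma kill_prob_spread1 (u : 'I_m) (x : vec) : (n <= u)%N -> spread1 x ->
  `|kill_prob q u x - p%:R^-1| <= eps.
Proof.
move=> nu /forallP/(_ (x u)) sp; apply: kill_prob_eps.
rewrite card_jump2// -mulnA; apply: leq_trans sp _.
by rewrite leq_pmull// prime_gt0.
Qed.

Lemma kill_prob_deviation2 (u : 'I_m) (x : vec) : (u < n)%N ->
  (N <= D * deviation2 (x u) x)%N ->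
  `|kill_prob q u x - p%:R^-1| <= eps.
Proof.
move=> un sp; apply: kill_prob_eps.
rewrite card_jump1// -mulnA; apply: leq_trans n_le_pN _.
by rewrite leq_mul2l sp orbT.
Qed.

Lemma kill_prob_spread2 (u : 'I_m) (x : vec) : (u < n)%N -> spread2 x ->
  `|kill_prob q u x - p%:R^-1| <= eps.
Proof. by move=> un /forallP sp; apply: kill_prob_deviation2. Qed.

Lemma card_low : #|[pred v : 'I_m | (v < n)%N]| = n.
Proof.
rewrite -sum1_card (eq_bigl (fun v : 'I_m => (v < n)%N)); last by move=> v; rewrite inE.
by rewrite -(big_ord_widen _ (fun=> 1%N)) ?leq_addr// sum1_card card_ord.
Qed.

(** More than n - n / D coordinates on V_1 are 0, hence differ from y u, and D >= 2 makes this at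
    least n / D. *)
Lemma kill_prob_few1 (u : 'I_m) (y : vec) : (n <= u)%N -> (D * deviation1 0%R y < n)%N ->
  y u != 0 -> `|kill_prob q u y - p%:R^-1| <= eps.
Proof.
move=> nu few yu; apply: kill_prob_eps; rewrite card_jump2// -mulnA.
apply: leq_trans (_ : D * deviation1 (y u) y <= _)%N; last first.
  by rewrite leq_pmull// prime_gt0.
have : (n <= deviation1 0%R y + deviation1 (y u) y)%N.
  rewrite -{1}card_low /deviation1 -cardUI; apply: leq_trans (leq_addr _ _).
  apply/subset_leq_card/fintype.subsetP => v; rewrite !inE => -> /=.
  by rewrite -negb_and; apply: contra yu => /andP[/eqP <- /eqP ->].
move: few D_ge2; set a := deviation1 _ _; set b := deviation1 _ _.
by clear; move=> *; nia.
Qed.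

Lemma kill_prob_ler_rho u (x : vec) : `|kill_prob q u x - p%:R^-1| <= eps ->
  kill_prob q u x <= rho.
Proof.
rewrite ler_norml => /andP[_ h]; have := rho_eps; lra.
Qed.

Lemma deviation_kappa1 (u : 'I_m) (y : vec) : (u < n)%N -> y u = 0 ->
  (0 < deviation2 0%R y)%N -> kill_prob q u y <= kappa.
Proof.
move=> un yu /card_gt0P[v]; rewrite !inE => /andP[nv yv].
by apply: (@kill_prob_kappa u v); rewrite /jump /adj un ltnNge nv /= yu subr0.
Qed.

Lemma deviation_kappa2 (u : 'I_m) (y : vec) : (n <= u)%N -> y u = 0 ->
  (0 < deviation1 0%R y)%N -> kill_prob q u y <= kappa.
Proof.
move=> nu yu /card_gt0P[v]; rewrite !inE => /andP[vn yv].
by apply: (@kill_prob_kappa u v); rewrite /jump /adj vn ltnNge nu /= yu subr0.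
Qed.

(** The blocks are V_1, the exposed rows of V_2 and the rows kept for the closing phase. *)
Lemma prod_blocks (a b c : R) :
  \prod_(u : 'I_m) (if (u < n)%N then a else if (u < i1)%N then b else c) =
  a ^+ n * b ^+ (i1 - n) * c ^+ (m - i1).
Proof.
rewrite -(big_mkord predT (fun u => if (u < n)%N then a else if (u < i1)%N then b else c)).
rewrite (@big_cat_nat _ _ _ n)//= ?leq_addr// -mulrA; congr (_ * _).
  rewrite big_nat (eq_bigr (fun=> a)) => [|i /andP[_ ->]//].
  by rewrite -big_nat prodr_const_nat subn0.
rewrite (@big_cat_nat _ _ _ i1)//=; congr (_ * _).
  rewrite big_nat (eq_bigr (fun=> b)) => [|i /andP[ni ->]]; last by rewrite ltnNge ni.
  by rewrite -big_nat prodr_const_nat.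
rewrite big_nat (eq_bigr (fun=> c)) => [|i /andP[ni _]].
  by rewrite -big_nat prodr_const_nat.
by rewrite !ltnNge ni (leq_trans n_le_i1 ni).
Qed.

Definition ifz (A B : R) (a : 'F_p) : R := if a == 0 then A else B.

Lemma sum_ifz A B : \sum_a ifz A B a = A + (p%:R - 1) * B.
Proof.
rewrite (bigD1 0)//= {1}/ifz eqxx; congr (_ + _).
rewrite (eq_bigr (fun=> B)) => [|a /negbTE a0]; last by rewrite /ifz a0.
rewrite sumr_const cardC1 card_Fp// -[LHS]mulr_natl -subn1 natrB//.
exact: prime_gt0.
Qed.

Lemma ifzM A B A' B' a : ifz A B a * ifz A' B' a = ifz (A * A') (B * B') a.
Proof. by rewrite /ifz; case: eqP. Qed.

Lemma ifz_ge0 A B a : 0 <= A -> 0 <= B -> 0 <= ifz A B a.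
Proof. by rewrite /ifz; case: eqP. Qed.

(* The constraint D * j < k on the number j of nonzero coordinates among k is
   relaxed to a product over coordinates: weight s for a zero one and s * t for
   a nonzero one. *)
Lemma tilt_ge1 j k : (D * j < k)%N -> 1 <= s ^+ k * t ^+ j.
Proof.
move=> jk; apply: le_trans (_ : (s ^+ D * t) ^+ j <= _); first exact: exprn_ege1.
by rewrite exprMn -exprM ler_wpM2r ?exprn_ge0 ?(ltW t_gt0)// ler_weXn2l// ltnW.
Qed.

Lemma prod_tilt (A : pred 'I_m) (y : vec) :
  \prod_(u | A u) ifz s (s * t) (y u) =
  s ^+ #|A| * t ^+ #|[pred u | A u && (y u != 0)]|.
Proof.
rewrite (eq_bigr (fun u => s * (if y u != 0 then t else 1))); last first.
  by move=> u _; rewrite /ifz; case: eqP => //=; rewrite mulr1.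
rewrite big_split prodr_const; congr (_ * _).
rewrite -big_mkcondr /= (eq_bigl (fun u => u \in [pred u | A u && (y u != 0)])).
  by rewrite prodr_const.
by move=> u; rewrite inE.
Qed.

Lemma tilt1 y : (D * deviation1 0%R y < n)%N ->
  1 <= \prod_(u : 'I_m | (u < n)%N) ifz s (s * t) (y u).
Proof.
move=> few; rewrite (@prod_tilt (fun u : 'I_m => (u < n)%N)).
by rewrite (_ : #|_| = n) ?tilt_ge1//; exact: card_low.
Qed.

Lemma card_high : #|[pred v : 'I_m | ~~ (v < n)%N]| = N.
Proof.
have := cardC [pred v : 'I_m | (v < n)%N]; rewrite card_low card_ord.
by move=> /addnI.
Qed.

Lemma tilt2 y : (D * deviation2 0%R y < N)%N ->
  1 <= \prod_(u : 'I_m | ~~ (u < n)%N) ifz s (s * t) (y u).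
Proof.
move=> few; rewrite (@prod_tilt (fun u : 'I_m => ~~ (u < n)%N)).
rewrite (_ : #|(fun u : 'I_m => ~~ (u < n)%N)| = N); last exact: card_high.
rewrite (_ : #|_| = deviation2 0%R y) ?tilt_ge1//.
by apply: eq_card => v; rewrite !inE -leqNgt.
Qed.

(** A sum over all vectors of a product over coordinates factors. Since P is dropped, any constraint
    that matters must already be encoded in g, which is the purpose of the tilt. *)
Lemma sum_le_prod (P : pred vec) (F : vec -> R) (g : 'I_m -> 'F_p -> R) :
  (forall u a, 0 <= g u a) -> (forall y, P y -> F y <= \prod_u g u (y u)) ->
  \sum_(y | P y) F y <= \prod_u \sum_a g u a.
Proof.
move=> g0 Fg; rewrite bigA_distr_bigA /=.
apply: le_trans (ler_sum _ Fg) _; rewrite [leRHS](bigID P)/= lerDl.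
by apply: sumr_ge0 => y _; apply: prodr_ge0.
Qed.

(** One summand for each range. If y vanishes on V_2, every exposed row of V_2 costs [kappa]. If y
    has few nonzero coordinates there, the rows of V_1 at zero coordinates cost [kappa], and both
    parts are tilted. If it has many, these rows cost [rho], as do the exposed rows of V_2 at
    nonzero coordinates, and the unexposed coordinates are free. *)
Definition few_bound : R :=
  (s + (p%:R - 1) * (s * t)) ^+ n * kappa ^+ (i1 - n) +
  (kappa * s + (p%:R - 1) * (s * t)) ^+ n * (s + (p%:R - 1) * (s * t)) ^+ N +
  (rho * s + (p%:R - 1) * (s * t)) ^+ n * (1 + (p%:R - 1) * rho) ^+ (i1 - n) *
    p%:R ^+ (m - i1).

Lemma prod_lower (f : 'I_m -> R) :
  \prod_(u : 'I_m | (u < n)%N) f u = \prod_(u : 'I_m) (if (u < n)%N then f u else 1).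
Proof. exact: big_mkcond. Qed.

Lemma rho_ge0 : 0 <= rho.
Proof. by apply: le_trans rho_eps; rewrite addr_ge0// invr_ge0. Qed.

(* Three ranges of the number of nonzero coordinates of y in the second part:
   none, few, many. *)
Lemma sum_few1_le :
  \sum_(y : vec | (y != 0) && (D * deviation1 0%R y < n)%N)
     \prod_(u : 'I_m | (u < i1)%N) kill_prob q u y <= few_bound.
Proof.
have s0 : 0 <= s by have := s_ge1; lra.
have st0 : 0 <= s * t by rewrite mulr_ge0// ltW.
have kp0 u x : 0 <= kill_prob q u x by exact: kill_prob_ge0.
have kp1 u x : kill_prob q u x <= 1 by exact: kill_prob_le1.
have few u y (c : R) : kill_prob q u y <= c -> 0 <= kill_prob q u y <= c by rewrite kp0.
rewrite /few_bound (bigID (fun y => deviation2 0%R y == 0%N))/= -addrA lerD//.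
  pose g (u : 'I_m) a : R := if (u < n)%N then ifz s (s * t) a
    else (if (u < i1)%N then ifz kappa 0 a else ifz 1 0 a).
  apply: le_trans (@sum_le_prod _ _ g _ _) _.
  - by move=> u a; rewrite /g; case: ifP => _; [|case: ifP => _]; rewrite ifz_ge0.
  - move=> y /andP[/andP[y0 few1] /eqP dev2].
    have ylow (u : 'I_m) : (n <= u)%N -> y u = 0.
      move=> nu; apply/eqP; rewrite -[_ == _]negbK; apply/negP => yu.
      by have := card0_eq dev2 u; rewrite !inE nu yu.
    have dev1 : (0 < deviation1 0%R y)%N.
      rewrite lt0n; apply: contra y0 => /eqP dev1.
      apply/eqP/ffunP => u; rewrite ffunE; have [un|nu] := ltnP u n; last exact: ylow.
      apply/eqP; rewrite -[_ == _]negbK; apply/negP => yu.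
      by have := card0_eq dev1 u; rewrite !inE un yu.
    rewrite -[leLHS]mul1r.
    rewrite (_ : \prod_u g u (y u) = \prod_(u : 'I_m | (u < n)%N) ifz s (s * t) (y u) *
      \prod_(u : 'I_m) (if (u < n)%N then 1 else g u (y u))); last first.
      rewrite prod_lower -big_split; apply: eq_bigr => u _ /=.
      by rewrite /g; case: ifP => _; rewrite ?mulr1 ?mul1r.
    apply: ler_pM => //; [exact: prodr_ge0|exact: tilt1|].
    rewrite big_mkcond; apply: ler_prod => u _.
    case: ltnP => ui; last first.
      rewrite ltnNge (leq_trans n_le_i1 ui) /= /g ltnNge (leq_trans n_le_i1 ui) /=.
      by rewrite ltnNge ui /= ylow ?(leq_trans n_le_i1 ui)// /ifz eqxx ler01 lexx.
    case: ltnP => un; first by rewrite kp0 kp1.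
    rewrite /g ltnNge un /= ui /ifz ylow// eqxx.
    by apply: few; apply: deviation_kappa2 => //; exact: ylow.
  - rewrite (eq_bigr (fun u : 'I_m => if (u < n)%N then s + (p%:R - 1) * (s * t)
      else if (u < i1)%N then kappa else 1)); last first.
      by move=> u _; rewrite /g; case: ifP => _; [|case: ifP => _];
        rewrite sum_ifz ?mulr0 ?addr0.
    by rewrite prod_blocks expr1n mulr1.
rewrite (bigID (fun y => D * deviation2 0%R y < N)%N)/= lerD//.
  pose g (u : 'I_m) a : R := if (u < n)%N then ifz kappa 1 a * ifz s (s * t) a
    else ifz s (s * t) a.
  apply: le_trans (@sum_le_prod _ _ g _ _) _.
  - by move=> u a; rewrite /g; case: ifP => _; rewrite ?mulr_ge0 ?ifz_ge0.
  - move=> y /andP[/andP[/andP[y0 few1] dev2] few2].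
    rewrite -[leLHS]mulr1 (_ : \prod_u g u (y u) =
        \prod_(u : 'I_m) (if (u < n)%N then ifz kappa 1 (y u) else 1) *
        (\prod_(u : 'I_m | (u < n)%N) ifz s (s * t) (y u) *
         \prod_(u : 'I_m | ~~ (u < n)%N) ifz s (s * t) (y u))); last first.
      rewrite [X in _ * (X * _)]big_mkcond [X in _ * (_ * X)]big_mkcond -!big_split.
      by apply: eq_bigr => u _; rewrite /g /=; case: ifP => _; rewrite ?mul1r ?mulr1.
    apply: ler_pM => //; [exact: prodr_ge0| |].
      rewrite big_mkcond; apply: ler_prod => u _.
      case: ltnP => ui; last by rewrite ltnNge (leq_trans n_le_i1 ui) ler01 lexx.
      case: ltnP => un; last by rewrite kp0 kp1.
      rewrite /ifz; case: eqP => yu; last by rewrite kp0 kp1.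
      by apply: few; apply: deviation_kappa1 => //; rewrite lt0n.
    by rewrite -[leLHS]mulr1 ler_pM// ?ler01// ?tilt1// tilt2.
  - rewrite (eq_bigr (fun u : 'I_m => if (u < n)%N
      then kappa * s + (p%:R - 1) * (s * t)
      else if (u < i1)%N then s + (p%:R - 1) * (s * t)
      else s + (p%:R - 1) * (s * t))); last first.
      move=> u _; rewrite /g; case: ifP => _; rewrite ?if_same ?sum_ifz//.
      by under eq_bigr do rewrite ifzM mul1r; rewrite sum_ifz.
    by rewrite prod_blocks -mulrA -exprD addnC addnBA// subnK// addKn.
pose g (u : 'I_m) a : R := if (u < n)%N then ifz rho 1 a * ifz s (s * t) a
  else (if (u < i1)%N then ifz 1 rho a else 1).
have r0 := rho_ge0.
apply: le_trans (@sum_le_prod _ _ g _ _) _.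
- move=> u a; rewrite /g; case: ifP => _; first by rewrite mulr_ge0 ?ifz_ge0.
  by case: ifP => _; rewrite ?ifz_ge0.
- move=> y /andP[/andP[/andP[y0 few1] _]]; rewrite -leqNgt => many2.
  rewrite -[leLHS]mul1r (_ : \prod_u g u (y u) =
      \prod_(u : 'I_m | (u < n)%N) ifz s (s * t) (y u) *
      \prod_(u : 'I_m) (if (u < n)%N then ifz rho 1 (y u) else g u (y u))); last first.
    rewrite [X in _ = X * _]big_mkcond -big_split; apply: eq_bigr => u _ /=.
    by rewrite /g; case: ifP => _; rewrite ?mul1r// mulrC.
  apply: ler_pM => //; [exact: prodr_ge0|exact: tilt1|].
  rewrite big_mkcond; apply: ler_prod => u _.
  case: ltnP => ui; last first.
    by rewrite /g ltnNge (leq_trans n_le_i1 ui) /= ltnNge ui /= ler01 lexx.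
  case: ltnP => un.
    rewrite /ifz; case: eqP => yu; last by rewrite kp0 kp1.
    by apply: few; apply: kill_prob_ler_rho; apply: kill_prob_deviation2; rewrite ?yu.
  rewrite /g ltnNge un /= ui /ifz; case: eqP => [_|/eqP yu]; first by rewrite kp0 kp1.
  by apply: few; apply: kill_prob_ler_rho; exact: kill_prob_few1.
rewrite (eq_bigr (fun u : 'I_m => if (u < n)%N
  then rho * s + (p%:R - 1) * (s * t)
  else if (u < i1)%N then 1 + (p%:R - 1) * rho else p%:R)); last first.
  move=> u _; rewrite /g; case: ifP => _.
    by under eq_bigr do rewrite ifzM mul1r; rewrite sum_ifz.
  by case: ifP => _; rewrite ?sum_ifz// sumr_const card_Fp.
by rewrite prod_blocks.
Qed.

(** The product of row u in V_1 with this vector is the out-degree of u modulo p, so a zero diagonal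
    entry is a [kills] event and the same estimates apply to it. *)
Definition diag_vec : vec := [ffun v : 'I_m => (n <= v)%N%:R].

Definition zero_diags (w : config) : nat :=
  #|[pred u : 'I_m | (u < n)%N && kills u (w u) diag_vec]|.

Lemma diag_kill_prob (u : 'I_m) : (u < n)%N -> kill_prob q u diag_vec <= p%:R^-1 + eps.
Proof.
move=> un; suff /(kill_prob_deviation2 un) : (N <= D * deviation2 (diag_vec u) diag_vec)%N.
  by rewrite ler_norml => /andP[_ h]; lra.
rewrite (_ : deviation2 _ _ = N) ?leq_pmull// 1?ltnW//.
rewrite -[RHS]card_high; apply: eq_card => v; rewrite !inE !ffunE.
rewrite [(n <= u)%N]leqNgt un /= -leqNgt; case: leqP => //= _; exact: oner_neq0.
Qed.

(** Exponential Markov inequality: [lambda ^+ zero_diags w] is a product over independent rows. *)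
Lemma zero_diags_tail (lambda : R) (z : nat) : 1 <= lambda ->
  lambda ^+ z * expect (row_law q) (fun w : config => (z < zero_diags w)%:R) <=
  (1 + (lambda - 1) * (p%:R^-1 + eps)) ^+ n.
Proof.
move=> l1; have lawP := row_lawP n N q_gt0 q_lt1.
rewrite -expectZ.
pose g (u : 'I_m) (r : row) : R :=
  if (u < n)%N then 1 + (lambda - 1) * (kills u r diag_vec)%:R else 1.
apply: le_trans (_ : expect (row_law q) (fun w : config => \prod_u g u (w u)) <= _).
  apply: expect_le => // w.
  have -> : \prod_u g u (w u) = lambda ^+ zero_diags w.
    rewrite -prodr_const [RHS]big_mkcond; apply: eq_bigr => u _; rewrite inE /g.
    by case: ifP => //= _; case: kills; rewrite /= ?mulr0 ?addr0// mulr1 subrKC.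
  case: ltnP => zw; last by rewrite mulr0 exprn_ge0//; lra.
  by rewrite mulr1 ler_weXn2l// ltnW.
rewrite expect_prod.
have := prod_blocks (1 + (lambda - 1) * (p%:R^-1 + eps)) 1 1.
rewrite !expr1n !mulr1 => <-.
apply: ler_prod => u _; apply/andP; split.
  apply: sumr_ge0 => r _; rewrite mulr_ge0//; first exact: lawP.1.
  by rewrite /g; case: ifP => // _; rewrite addr_ge0// mulr_ge0//; lra.
rewrite /g; case: ifP => un; last first.
  by under eq_bigr do rewrite mulr1; rewrite lawP.2 if_same.
have -> : \sum_r row_law q u r * (1 + (lambda - 1) * (kills u r diag_vec)%:R) =
  1 + (lambda - 1) * kill_prob q u diag_vec.
  rewrite -[X in _ = X + _](expect_cst 1 (arc_lawP q_gt0 q_lt1 u)).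
  by rewrite -expectZ -expectD.
by rewrite lerD2l ler_wpM2l ?diag_kill_prob//; lra.
Qed.

(** With the coordinates on V_2 fixed, row u of V_1 depends on y through y u alone, so the sum over
    the coordinates on V_1 factors. *)
Definition upper_part (y : vec) : vec :=
  [ffun v : 'I_m => if (v < n)%N then 0 else y v].

(* On the event [zero_diags w <= z] the factors 1/p multiply to at least p ^- z. *)
Definition damped (u : 'I_m) (y : vec) (a : 'F_p) : R :=
  expect (arc_law q u) (fun r : row => (if kills u r diag_vec then p%:R^-1 else 1) *
    (\sum_v (if adj u v then y v - a else 0) *+ r v == 0)%:R).

Lemma damped_ge0 u y a : 0 <= damped u y a.
Proof.
apply: expect_ge0 => [|r]; first exact: arc_lawP.
by rewrite mulr_ge0//; case: ifP => _ //; rewrite invr_ge0.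
Qed.

Lemma damped_upper (u : 'I_m) y a : (u < n)%N ->
  damped u (upper_part y) a = damped u y a.
Proof.
move=> un; apply: eq_expect => r; congr (_ * (nat_of_bool (_ == 0))%:R).
apply: eq_bigr => v _; congr (_ *+ _); rewrite ffunE /adj un.
by case: ltnP.
Qed.

(* A zero diagonal entry leaves p choices of a, a nonzero one at most one. *)
Lemma sum_damped (u : 'I_m) y : (u < n)%N -> \sum_a damped u y a <= 1.
Proof.
move=> un; rewrite /damped -expect_sum.
rewrite -[leRHS](expect_cst 1 (arc_lawP q_gt0 q_lt1 u)).
apply: expect_le => [|r]; first exact: arc_lawP.
rewrite -mulr_sumr; set d : 'F_p := \sum_v jump diag_vec u v *+ r v.
have E a : \sum_v (if adj u v then y v - a else 0) *+ r v =
    \sum_v (if adj u v then y v else 0) *+ r v - a * d.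
  rewrite mulr_sumr -sumrB; apply: eq_bigr => v _.
  rewrite mulrnAr -mulrnBl /jump /adj un; congr (_ *+ _).
  case: ltnP => /= nv; first by rewrite mulr0 subr0.
  by rewrite !ffunE nv leqNgt un /= subr0 mulr1.
rewrite /kills -/d; case: eqP => [_|/eqP d0].
  rewrite -ler_pdivlMl ?invr_gt0 ?ltr0n ?prime_gt0// invrK mulr1.
  apply: le_trans (_ : \sum_(a : 'F_p) 1 <= _).
    by apply: ler_sum => a _; rewrite lern1 leq_b1.
  by rewrite sumr_const card_Fp.
rewrite mul1r (bigD1 ((\sum_v (if adj u v then y v else 0) *+ r v) / d))//=.
rewrite [X in _ + X]big1 ?addr0 => [|a]; first by case: (_ == _).
move=> ne; rewrite E subr_eq0; case: eqP => // e.
by rewrite e mulfK// eqxx in ne.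
Qed.

Lemma expect_damped z (y : vec) :
  expect (row_law q) (fun w : config =>
    (zero_diags w <= z)%N%:R * (y \in null_vecs p i1 w)%:R) <=
  p%:R ^+ z * (\prod_(u : 'I_m | (u < n)%N) damped u (upper_part y) (y u) *
    \prod_(u : 'I_m | ~~ (u < n)%N && (u < i1)%N) kill_prob q u y).
Proof.
have lawP := row_lawP n N q_gt0 q_lt1.
have p1 : 1 <= p%:R :> R by rewrite ler1n prime_gt0.
have p0 : 0 < p%:R :> R by lra.
pose h (u : 'I_m) (r : row) : R := if (u < n)%N then
  (if kills u r diag_vec then p%:R^-1 else 1) * (kills u r y)%:R
  else if (u < i1)%N then (kills u r y)%:R else 1.
have -> : \prod_(u : 'I_m | (u < n)%N) damped u (upper_part y) (y u) *
    \prod_(u : 'I_m | ~~ (u < n)%N && (u < i1)%N) kill_prob q u y =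
    expect (row_law q) (fun w : config => \prod_u h u (w u)).
  rewrite expect_prod big_mkcondr [X in X * _]big_mkcond [X in _ * X]big_mkcond.
  rewrite -big_split; apply: eq_bigr => u _ /=; rewrite /h.
  case: ifP => un; first by rewrite mulr1 damped_upper.
  case: ifP => ui; rewrite mul1r//.
  by under eq_bigr do rewrite mulr1; rewrite lawP.2.
rewrite -expectZ; apply: expect_le => // w.
have -> : \prod_u h u (w u) =
    p%:R^-1 ^+ zero_diags w * (y \in null_vecs p i1 w)%:R.
  rewrite mem_kernel_prod -prodr_const [X in X * _]big_mkcond.
  rewrite [X in _ * X]big_mkcond -big_split; apply: eq_bigr => u _.
  rewrite !inE /h; case: ifP => un /=; last by rewrite mul1r.
  by rewrite (leq_trans un n_le_i1); case: kills.
rewrite mulrA ler_wpM2r//; case: leqP => zw; last first.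
  by rewrite mulr_ge0 ?exprn_ge0 ?invr_ge0// ltW.
by rewrite exprVn -expfB_cond ?gt_eqF// exprn_ege1.
Qed.

Lemma sum_damped_le :
  \sum_(y : vec) \prod_(u : 'I_m)
    (if (u < n)%N then damped u (upper_part y) (y u) else ifz s (s * t) (y u)) <=
  (s + (p%:R - 1) * (s * t)) ^+ N.
Proof.
have s0 : 0 <= s by have := s_ge1; lra.
have st0 : 0 <= s * t by rewrite mulr_ge0// ltW.
pose g (u : 'I_m) a : R := if (u < n)%N then ifz 1 0 a else ifz s (s * t) a.
have g0 u a : 0 <= g u a by rewrite /g; case: ifP => _; rewrite ifz_ge0.
have := prod_blocks 1 (s + (p%:R - 1) * (s * t)) (s + (p%:R - 1) * (s * t)).
have e : (i1 - n + (m - i1) = N)%N by rewrite addnC addnBA// subnK// addKn.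
rewrite -mulrA -exprD expr1n mul1r e => <-.
rewrite (partition_big upper_part predT)//=.
rewrite (eq_bigr (fun u : 'I_m => \sum_a g u a)); last first.
  by move=> u _; rewrite /g; case: ifP => _; rewrite ?if_same ?sum_ifz ?mulr0 ?addr0.
apply: sum_le_prod => // z _.
pose h (u : 'I_m) a : R := if (u < n)%N then damped u z a
  else ifz s (s * t) a * (a == z u)%:R.
(* A value of [upper_part] vanishes on V_1; for any other z the fibre is empty. *)
have [zlow|] := boolP [forall u : 'I_m, (u < n)%N ==> (z u == 0)]; last first.
  move=> /forallPn[u]; rewrite negb_imply => /andP[un zu].
  rewrite big_pred0 ?prodr_ge0// => y; apply/negP => /eqP yz.
  by move: zu; rewrite -yz ffunE un eqxx.
apply: le_trans (@sum_le_prod _ _ h _ _) _.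
- move=> u a; rewrite /h; case: ifP => _; first exact: damped_ge0.
  by rewrite mulr_ge0 ?ifz_ge0.
- move=> y /eqP yz; apply: ler_prod => u _; rewrite /h; case: ifP => un.
    by rewrite yz damped_ge0 lexx.
  by rewrite -yz ffunE un eqxx mulr1 ifz_ge0/=.
apply: ler_prod => u _; rewrite sumr_ge0/=; last first.
  by move=> a _; rewrite /h; case: ifP => _; rewrite ?damped_ge0 ?mulr_ge0 ?ifz_ge0.
rewrite /g /h; case: ifP => un.
  by move/forallP/(_ u): zlow; rewrite un /= /ifz => ->; exact: sum_damped.
rewrite (bigD1 (z u))//= eqxx mulr1 big1 ?addr0// => a /negbTE ->.
by rewrite mulr0.
Qed.

(** At most z free coordinates on V_1, a factor close to 1/p for each exposed row of V_2, and the
    tilted count of the vectors with few nonzero coordinates on V_2. *)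
Definition zero_bound (z : nat) : R :=
  p%:R ^+ z * (p%:R^-1 + eps) ^+ (i1 - n) * (s + (p%:R - 1) * (s * t)) ^+ N.

Lemma prod_middle (c : R) :
  \prod_(u : 'I_m | ~~ (u < n)%N && (u < i1)%N) c = c ^+ (i1 - n).
Proof.
have := prod_blocks 1 c 1; rewrite !expr1n mul1r mulr1 => <-.
rewrite big_mkcond; apply: eq_bigr => u _.
by case: ltnP => //= _; case: ifP.
Qed.

Lemma sum_few2_le z :
  \sum_(y : vec | spread1 y && (D * deviation2 0%R y < N)%N)
    expect (row_law q) (fun w : config =>
      (zero_diags w <= z)%N%:R * (y \in null_vecs p i1 w)%:R) <= zero_bound z.
Proof.
have s0 : 0 <= s by have := s_ge1; lra.
have st0 : 0 <= s * t by rewrite mulr_ge0// ltW.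
have pe0 : 0 <= p%:R^-1 + eps by rewrite addr_ge0// invr_ge0.
have -> : zero_bound z = p%:R ^+ z * (p%:R^-1 + eps) ^+ (i1 - n) *
  (s + (p%:R - 1) * (s * t)) ^+ N by [].
apply: le_trans (ler_wpM2l _ sum_damped_le); last by rewrite mulr_ge0// exprn_ge0.
rewrite mulr_sumr [leRHS](bigID (fun y => spread1 y && (D * deviation2 0%R y < N)%N))/=.
rewrite -[leLHS]addr0 lerD//; last first.
  apply: sumr_ge0 => y _; rewrite mulr_ge0//; first by rewrite mulr_ge0// exprn_ge0.
  by apply: prodr_ge0 => u _; case: ifP => _; rewrite ?damped_ge0 ?ifz_ge0.
apply: ler_sum => y /andP[sp few2].
apply: le_trans (expect_damped z y) _.
rewrite -mulrA ler_wpM2l ?exprn_ge0//.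
have -> : \prod_(u : 'I_m) (if (u < n)%N then damped u (upper_part y) (y u)
      else ifz s (s * t) (y u)) =
    \prod_(u : 'I_m | (u < n)%N) damped u (upper_part y) (y u) *
    \prod_(u : 'I_m | ~~ (u < n)%N) ifz s (s * t) (y u).
  rewrite [X in _ = X * _]big_mkcond [X in _ = _ * X]big_mkcond -big_split.
  by apply: eq_bigr => u _ /=; case: ifP; rewrite ?mulr1 ?mul1r.
rewrite mulrCA ler_wpM2l//; first by apply: prodr_ge0 => u _; exact: damped_ge0.
rewrite -[leLHS]mulr1 ler_pM ?tilt2//; first by apply: prodr_ge0 => u _; exact: kill_prob_ge0.
rewrite -prod_middle; apply: ler_prod => u /andP[nu _]; rewrite kill_prob_ge0//=.
rewrite -leqNgt in nu; have := kill_prob_spread1 nu sp.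
by rewrite ler_norml => /andP[_ h]; lra.
Qed.

Definition shift (c : 'F_p) (x : vec) : vec := [ffun v => x v + c].

Lemma shiftK c : cancel (shift c) (shift (- c)).
Proof. by move=> x; apply/ffunP => v; rewrite !ffunE addrK. Qed.

Lemma jump_shift c x u v : jump (shift c x) u v = jump x u v.
Proof. by rewrite /jump !ffunE opprD addrACA subrr addr0. Qed.

Lemma mem_null_vecs_shift c x j (w : config) :
  (shift c x \in null_vecs p j w) = (x \in null_vecs p j w).
Proof.
rewrite !inE; apply: eq_forallb => u; congr (_ ==> (_ == 0)).
by apply: eq_bigr => v _; rewrite jump_shift.
Qed.

Lemma deviation1_shift c d x : deviation1 d (shift c x) = deviation1 (d - c) x.
Proof. by apply: eq_card => v; rewrite !inE ffunE eq_sym -subr_eq eq_sym. Qed.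

Lemma deviation2_shift c d x : deviation2 d (shift c x) = deviation2 (d - c) x.
Proof. by apply: eq_card => v; rewrite !inE ffunE eq_sym -subr_eq eq_sym. Qed.

Lemma spread1_shift c x : spread1 (shift c x) = spread1 x.
Proof.
apply/forallP/forallP => sp d.
  by have := sp (d + c); rewrite deviation1_shift addrK.
by rewrite deviation1_shift.
Qed.

(** Adding a constant vector preserves membership in the null space, so nearly constant reduces to
    nearly zero at the price of a factor p. *)
Lemma sum_shift_le (P Q : pred vec) (F : vec -> R) (B : R) :
  (forall x, 0 <= F x) -> (forall c x, F (shift c x) = F x) ->
  (forall x, Q x -> exists c, P (shift (- c) x)) ->
  \sum_(y | P y) F y <= B -> \sum_(x | Q x) F x <= p%:R * B.
Proof.
move=> F0 Fs QP PB.
apply: le_trans (_ : \sum_x \sum_c (if P (shift (- c) x) then F x else 0) <= _).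
  rewrite big_mkcond; apply: ler_sum => x _; case: ifP => [/QP[c Pc]|_].
    rewrite (bigD1 c)//= Pc lerDl sumr_ge0// => d _.
    by case: ifP.
  by apply: sumr_ge0 => c _; case: ifP.
rewrite (_ : p%:R * B = \sum_(c : 'F_p) B); last first.
  by rewrite sumr_const card_Fp// mulr_natl.
rewrite exchange_big /=.
apply: ler_sum => c _; rewrite -big_mkcond /=.
rewrite (reindex_inj (can_inj (shiftK c))) /=.
by rewrite (eq_big P F)// => x; rewrite shiftK.
Qed.

Lemma sum_unspread1_le :
  \sum_(x : vec | ~~ is_cst x && ~~ spread1 x)
    expect (row_law q) (fun w : config => (x \in null_vecs p i1 w)%:R) <=
  p%:R * few_bound.
Proof.
apply: (@sum_shift_le (fun y => (y != 0) && (D * deviation1 0%R y < n)%N)).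
- by move=> x; apply: expect_ge0 => [|w]; [exact: row_lawP|exact: ler0n].
- by move=> c x; apply: eq_expect => w; rewrite mem_null_vecs_shift.
- move=> x /andP[nc /forallPn[c]]; rewrite -ltnNge => few; exists c.
  rewrite deviation1_shift sub0r opprK few andbT.
  apply: contra nc => /eqP e; apply/codomP; exists c.
  rewrite -[x](shiftK (- c)) e opprK; apply/ffunP => v.
  by rewrite !ffunE add0r.
- rewrite (eq_bigr _ (fun x _ => expect_mem_kernel q_gt0 q_lt1 i1 x)).
  exact: sum_few1_le.
Qed.

Lemma sum_unspread2_le z :
  \sum_(x : vec | spread1 x && ~~ spread2 x)
    expect (row_law q) (fun w : config =>
      (zero_diags w <= z)%N%:R * (x \in null_vecs p i1 w)%:R) <=
  p%:R * zero_bound z.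
Proof.
apply: (@sum_shift_le (fun y => spread1 y && (D * deviation2 0%R y < N)%N)).
- by move=> x; apply: expect_ge0 => [|w]; [exact: row_lawP|rewrite mulr_ge0].
- by move=> c x; apply: eq_expect => w; rewrite mem_null_vecs_shift.
- move=> x /andP[sp /forallPn[c]]; rewrite -ltnNge => few; exists c.
  by rewrite deviation2_shift sub0r opprK few andbT spread1_shift.
- exact: sum_few2_le.
Qed.

(** At most p ^ m vectors are spread on both parts, each surviving with probability at most (1/p +
    eps) ^ i1. The truncation is used only for those spread on V_1 but not on V_2. *)
Lemma first_moment z : (0 < m)%N ->
  expect (row_law q) (fun w : config =>
    (zero_diags w <= z)%N%:R * #|null_vecs p i1 w|%:R) <=
  p%:R ^+ (m - i1) * (1 + p%:R * eps) ^+ i1 +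
  (p%:R + p%:R * few_bound + p%:R * zero_bound z).
Proof.
move=> m0; have lawP := row_lawP n N q_gt0 q_lt1.
have p0 : 0 < p%:R :> R by rewrite ltr0n prime_gt0.
pose F x := expect (row_law q) (fun w : config =>
    (zero_diags w <= z)%N%:R * (x \in null_vecs p i1 w)%:R).
pose F' x := expect (row_law q) (fun w : config => (x \in null_vecs p i1 w)%:R : R).
have FF' x : F x <= F' x.
  by apply: expect_le => // w; rewrite ler_piMl// lern1 leq_b1.
have F'1 x : F' x <= 1.
  by rewrite -[leRHS](expect_cst 1 lawP); apply: expect_le => // w; rewrite lern1 leq_b1.
have F0 x : 0 <= F x by apply: expect_ge0 => // w; rewrite mulr_ge0.
rewrite (@eq_expect _ _ _ _ _ (fun w : config =>
    \sum_x (zero_diags w <= z)%N%:R * (x \in null_vecs p i1 w)%:R)); last first.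
  move=> w; rewrite -mulr_sumr -sum1_card natr_sum big_mkcond.
  by congr (_ * _); apply: eq_bigr => x _; case: (_ \in _).
rewrite expect_sum -/(F _) (bigID (fun x => spread1 x && spread2 x))/= lerD//.
  apply: le_trans (_ : \sum_(x : vec) (p%:R^-1 + eps) ^+ i1 <= _).
    rewrite [leRHS](bigID (fun x => spread1 x && spread2 x))/= -[leLHS]addr0.
    rewrite lerD ?sumr_ge0//; last by move=> x _; rewrite exprn_ge0// addr_ge0// invr_ge0.
    apply: ler_sum => x /andP[sp1 sp2]; apply: le_trans (FF' x) _.
    rewrite /F' (expect_mem_kernel q_gt0 q_lt1).
    have : \prod_(u : 'I_m | (u < i1)%N) (p%:R^-1 + eps) = (p%:R^-1 + eps) ^+ i1.
      have := prod_blocks (p%:R^-1 + eps) (p%:R^-1 + eps) 1.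
      rewrite expr1n mulr1 -exprD subnKC// => <-; rewrite big_mkcond.
      apply: eq_bigr => u _; case: ltnP => ui; last first.
        by rewrite ltnNge (leq_trans n_le_i1 ui).
      by rewrite if_same.
    move=> <-; apply: ler_prod => u ui; rewrite kill_prob_ge0//=.
    suff : `|kill_prob q u x - p%:R^-1| <= eps by rewrite ler_norml => /andP[_ h]; lra.
    have [un|nu] := ltnP u n; first exact: kill_prob_spread2.
    exact: kill_prob_spread1.
  rewrite sumr_const card_ffun card_Fp// card_ord -[leLHS]mulr_natl natrX.
  rewrite -[in leLHS](subnK i1_le_m) exprD -mulrA -exprMn mulrDr divff ?gt_eqF//.
rewrite (bigID spread1)/= addrC lerD//.
  rewrite (bigID (fun x => is_cst x))/= lerD//.
    apply: (@le_trans _ _ (\sum_(x : vec | is_cst x) (1 : R))).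
      rewrite [leRHS](bigID (fun x => ~~ (spread1 x && spread2 x) && ~~ spread1 x))/=.
      rewrite -[leLHS]addr0 lerD ?sumr_ge0//.
      rewrite (eq_bigl (fun x => is_cst x && (~~ (spread1 x && spread2 x) && ~~ spread1 x))).
        by apply: ler_sum => x _; apply: le_trans (FF' x) _.
      by move=> x; rewrite andbC.
    have -> : \sum_(x : vec | is_cst x) 1 = #|@is_cst p n N|%:R :> R.
      by rewrite -sum1_card natr_sum; apply: eq_bigl.
    by rewrite card_is_cst.
  apply: le_trans sum_unspread1_le.
  rewrite (eq_bigl (fun x => ~~ is_cst x && ~~ spread1 x)).
    by apply: ler_sum => x _; exact: FF'.
  by move=> x; case: (spread1 x); rewrite /= ?andbF ?andbT.
rewrite (eq_bigl (fun x => spread1 x && ~~ spread2 x)); first exact: sum_unspread2_le.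
by move=> x; case: (spread1 x); rewrite /= ?andbF ?andbT.
Qed.

(** The probability of many zero diagonal entries counts twice: as a failure, and as mass removed
    from the truncated first moment. *)
Lemma failure_bound z : (0 < m)%N ->
  expect (row_law q) (fun w : config => (~~ success spread1 i1 w)%:R) <=
  2 * expect (row_law q) (fun w : config => (z < zero_diags w)%N%:R) +
  ((1 + p%:R * eps) ^+ i1 - 1) + p%:R * few_bound +
  p%:R^-1 ^+ (m - i1) * (p%:R + p%:R * few_bound + p%:R * zero_bound z).
Proof.
move=> m0; have lawP := row_lawP n N q_gt0 q_lt1.
have p2 : 2 <= p%:R :> R by rewrite ler_nat prime_gt1.
set P := expect _ (fun w => (z < _)%N%:R).
pose P2 := expect (row_law q) (fun w : config => (~~ tame spread1 i1 w)%:R : R).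
pose wrong (w : config) := (zero_diags w <= z)%N &&
  (corank (partial_mx p i1 w) != (m - i1)%N).
pose P3 := expect (row_law q) (fun w : config => (wrong w)%:R : R).
have P2le : P2 <= p%:R * few_bound.
  apply: le_trans sum_unspread1_le; rewrite -expect_sum; apply: expect_le => // w.
  case: (boolP (tame _ _ _)) => [_|]; first by apply: sumr_ge0.
  move=> /forallPn[x]; rewrite !negb_imply negb_or => /and3P[xK xc xs].
  by rewrite (bigD1 x)/= ?xc ?xs// xK lerDl sumr_ge0.
have sub : expect (row_law q) (fun w : config => (~~ success spread1 i1 w)%:R) <=
    P + P2 + P3.
  rewrite -!expectD; apply: expect_le => // w; rewrite /success /wrong.
  rewrite ltnNge; case: (_ <= _)%N; case: (tame _ _ _); case: (_ == _);
    by rewrite /= ?addr0 ?add0r ?lerDl ?lexx.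
set X : R := p%:R ^+ (m - i1).
have X1 : 1 <= X by rewrite exprn_ege1//; lra.
have moment : X * (1 - P) + X * P3 <= X * (1 + p%:R * eps) ^+ i1 +
    (p%:R + p%:R * few_bound + p%:R * zero_bound z).
  apply: le_trans (first_moment z m0).
  rewrite -[X in _ * (X - _)](expect_cst 1 lawP) -expectB -!expectZ -expectD.
  apply: expect_le => // w; rewrite (card_kernel p_prime) natrX /wrong -/X.
  case: ltnP => zw /=; first by rewrite subrr !mulr0 mul0r addr0.
  rewrite subr0 mulr1 mul1r; have := corank_partial_geq p_prime i1 w.
  rewrite leq_eqVlt => /predU1P[<-|lt]; first by rewrite eqxx mulr0 addr0.
  (* An excess dimension multiplies the cardinality by at least p >= 2, which pays for [X + X]. *)
  rewrite gtn_eqF// mulr1; apply: le_trans (_ : p%:R * X <= _); first by nra.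
  by rewrite -exprS ler_weXn2l//; lra.
have -> : p%:R^-1 ^+ (m - i1) * (p%:R + p%:R * few_bound + p%:R * zero_bound z) =
   (p%:R + p%:R * few_bound + p%:R * zero_bound z) / X by rewrite exprVn mulrC.
set Y := p%:R + _ + _ in moment *.
have : 1 - P + P3 <= (1 + p%:R * eps) ^+ i1 + Y / X.
  rewrite -(@ler_pM2l _ X); last by lra.
  rewrite [leRHS]mulrDr [X in _ <= _ + X]mulrCA divff ?mulr1; last by lra.
  by apply: le_trans moment; rewrite mulrDr.
lra.
Qed.

End FirstMoment.

(** * Explicit error bound for the corank law *)

Lemma expr_le_expr (R : realType) (k j n : nat) (theta r : R) :
  0 <= theta -> 0 <= r <= 1 -> theta <= r ^+ k -> (n <= k * j)%N ->
  theta ^+ j <= r ^+ n.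
Proof.
move=> theta0 /andP[r0 r1] le nj; apply: le_trans (_ : (r ^+ k) ^+ j <= _).
  by apply: lerXn2r; rewrite ?nnegrE ?exprn_ge0.
by rewrite -exprM ler_wiXn2l.
Qed.

(** All row estimates share the error r ^ n, where r dominates a (p D)-th root of [conc_rate]:
    spread vectors have at least n / (p D) jumps. *)
Lemma corank_law_bound (R : realType) (p n N D L z k : nat) (q s t r rho lambda few : R) :
  prime p -> 0 < q -> q < 1 -> (2 <= D)%N -> (n <= p * N)%N ->
  (0 < L)%N -> (L <= N)%N -> 1 <= s -> 0 < t -> 1 <= s ^+ D * t ->
  0 <= r <= 1 -> conc_rate p q <= r ^+ (p * D) -> p%:R^-1 + r ^+ n <= rho ->
  1 <= lambda ->
  few = few_bound p n N (n + (N - L)) s t rho (Num.max q (1 - q)) ->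
  `| bip_prob q (fun G : digraph (n + N) =>
        corank (mx_mod p (laplacian G)) == (1 + k)%N) - limit_law R p k | <=
  2 * ((1 + (lambda - 1) * (p%:R^-1 + r ^+ n)) ^+ n / lambda ^+ z) +
  ((1 + p%:R * r ^+ n) ^+ (n + (N - L)) - 1) + p%:R * few +
  p%:R^-1 ^+ L * (p%:R + p%:R * few + p%:R * zero_bound p n N (n + (N - L)) s t (r ^+ n) z) +
  L%:R * (2 * r ^+ n) + 4 * p%:R^-1 ^+ L.
Proof.
move=> p_prime q0 q1 D2 npN L0 LN s1 t0 sDt r01 rD rhor l1 fewE.
set i1 := (n + (N - L))%N in fewE *.
have i1m : (i1 <= n + N)%N by rewrite leq_add2l leq_subr.
have ni1 : (n <= i1)%N by rewrite leq_addr.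
have Li : (n + N - i1 = L)%N by rewrite subnDl subKn.
have m0 : (0 < n + N)%N by rewrite addn_gt0 (leq_trans L0 LN) orbT.
have e0 : 0 <= r ^+ n by move: r01 => /andP[? _]; rewrite exprn_ge0.
have k0 : 0 <= Num.max q (1 - q) by rewrite le_max (ltW q0).
have conc (u : 'I_(n + N)) (x : {ffun 'I_(n + N) -> 'F_p}) :
    (n <= p * D * #|[pred v | jump x u v != 0%R]|)%N ->
    `|kill_prob q u x - p%:R^-1| <= r ^+ n.
  move=> le; apply: le_trans (kill_prob_conc p_prime q0 q1 u x) _.
  by have /andP[/ltW c0 _] := conc_rate_itv p q0 q1; exact: expr_le_expr le.
have kap (u v : 'I_(n + N)) (x : {ffun 'I_(n + N) -> 'F_p}) :
    jump x u v != 0 -> kill_prob q u x <= Num.max q (1 - q).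
  exact: kill_prob_le_max.
have fail := failure_bound p_prime q0 q1 D2 npN ni1 i1m s1 t0 sDt k0 e0 rhor conc kap z m0.
have tail := zero_diags_tail q0 q1 D2 npN ni1 i1m conc z l1.
have close (u : 'I_(n + N)) (x : {ffun 'I_(n + N) -> 'F_p}) : (i1 <= u)%N -> spread1 D x ->
    `|kill_prob q u x - p%:R^-1| <= r ^+ n.
  by move=> iu; apply: (kill_prob_spread1 p_prime conc); exact: leq_trans iu.
have chn := final_corank_chain p_prime q0 q1 close e0 k i1m m0.
have lim := @limit_law_chain R p k L p_prime L0.
rewrite Li in fail chn.
rewrite (bip_prob_expect q) (@eq_expect _ _ _ _ _ (fun w =>
  (corank (partial_mx p (n + N) w) == k.+1)%:R)); last first.
  by move=> w; rewrite corank_partial_full add1n.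
set A := expect _ _ in chn *; set B := chain _ _ _ _ in chn lim.
set F := expect _ _ in chn fail; set P := expect _ _ in fail tail.
have {}tail : P <= (1 + (lambda - 1) * (p%:R^-1 + r ^+ n)) ^+ n / lambda ^+ z.
  by rewrite ler_pdivlMr ?exprn_gt0 1?mulrC//; lra.
rewrite -fewE in fail.
have : `|A - limit_law R p k| <= `|A - B| + `|B - limit_law R p k|.
  by rewrite -[X in `|X|](subrKA B) ler_normD.
lra.
Qed.

(** * Exponentially small sequences *)

Section ExponentiallySmall.
Variable R : realType.
Implicit Types (f g : nat -> R).

Definition exp_small f := exists r K n0,
  [/\ 0 < r, r < 1, 0 <= K & forall n, (n0 <= n)%N -> f n <= K * r ^+ n].

Lemma exp_small_geo (K r : R) : 0 <= K -> 0 <= r -> r < 1 ->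
  exp_small (fun n => K * r ^+ n).
Proof.
move=> K0 r0 r1; exists ((r + 1) / 2), K, 0%N; split=> //; [lra|lra|].
by move=> n _; rewrite ler_wpM2l// lerXn2r ?nnegrE//; lra.
Qed.

Lemma exp_smallD f g : exp_small f -> exp_small g -> exp_small (fun n => f n + g n).
Proof.
move=> [r [K [n0 [r0 r1 K0 fr]]]] [r' [K' [n0' [r'0 r'1 K'0 gr]]]].
exists (Num.max r r'), (K + K'), (maxn n0 n0'); split.
- by rewrite lt_max r0.
- by rewrite gt_max r1.
- exact: addr_ge0.
move=> n; rewrite geq_max => /andP[nn nn']; rewrite mulrDl lerD//.
  apply: le_trans (fr n nn) _.
  by rewrite ler_wpM2l// lerXn2r ?nnegrE ?le_max ?(ltW r0) ?lexx.
apply: le_trans (gr n nn') _.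
by rewrite ler_wpM2l// lerXn2r ?nnegrE ?le_max ?(ltW r0) ?(ltW r'0) ?lexx ?orbT.
Qed.

(** The larger rate (r + 1) / 2 = (1 + h) r absorbs the factor n, since n h <= (1 + h) ^ n. *)
Lemma exp_small_linear (K r : R) : 0 <= K -> 0 < r -> r < 1 ->
  exp_small (fun n => K * (n%:R * r ^+ n)).
Proof.
move=> K0 r0 r1; set r' := (r + 1) / 2.
have rr' : r < r' by rewrite /r'; lra.
pose h := r' / r - 1.
have h0 : 0 < h by rewrite subr_gt0 ltr_pdivlMr// mul1r.
exists r', (K / h), 0%N; split; [lra|rewrite /r'; lra|by rewrite divr_ge0// ltW|].
move=> n _; rewrite -mulrA ler_wpM2l// [leRHS]mulrC ler_pdivlMr//.
rewrite (_ : r' ^+ n = (1 + h) ^+ n * r ^+ n); last first.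
  by rewrite -exprMn /h subrKC divfK// gt_eqF.
rewrite mulrAC ler_wpM2r ?exprn_ge0 ?(ltW r0)//.
elim: n => [|n IHn]; first by rewrite mul0r expr0.
rewrite exprS -natr1; have : 1 <= (1 + h) ^+ n by rewrite exprn_ege1//; lra.
nra.
Qed.

Lemma exp_small_expR f (c : R) : exp_small f -> 0 < c ->
  exists C K n0, [/\ 0 < C, 0 < K &
    forall n, (n0 <= n)%N -> f n <= K * expR (- (C * n%:R / c))].
Proof.
move=> [r [K [n0 [r0 r1 K0 fr]]]] c0.
have lnr : ln r < 0 by rewrite ln_lt0// r0 r1.
(* The constant C absorbs the denominator c, which will be the fixed number p ^ 2. *)
exists (- ln r * c), (K + 1), n0; split=> [||n nn].
- by rewrite mulr_gt0// oppr_gt0.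
- by lra.
apply: le_trans (fr n nn) _.
rewrite (_ : - (- ln r * c * n%:R / c) = ln r * n%:R); last by field; rewrite gt_eqF.
rewrite [ln r * _]mulrC expRM_natl lnK ?posrE//.
by rewrite ler_wpM2r ?exprn_ge0 ?(ltW r0)//; lra.
Qed.

(** With h = (1 - theta) / (k + 1), Bernoulli gives (1 - h) ^ k >= 1 - k h = theta + h; the
    denominator k + 1 also covers k = 0. *)
Lemma exists_root (theta : R) k : 0 <= theta -> theta < 1 ->
  exists2 r : R, 0 < r < 1 & theta <= r ^+ k.
Proof.
move=> t0 t1; pose h := (1 - theta) / k.+1%:R.
have k0 : 0 < k.+1%:R :> R by rewrite ltr0n.
have h0 : 0 < h by rewrite divr_gt0// subr_gt0.
have h1 : k.+1%:R * h = 1 - theta by rewrite mulrC divfK// gt_eqF.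
have h2 : h <= 1 - theta.
  by rewrite -h1 ler_peMl ?(ltW h0)// ler1n.
have [-> | theta0] := eqVneq theta 0; first by exists (1 / 2); [lra|rewrite exprn_ge0//; lra].
have t_gt0 : 0 < theta by rewrite lt_neqAle eq_sym theta0.
exists (1 - h); first by apply/andP; split; lra.
have : 1 - k%:R * h <= (1 - h) ^+ k.
  elim: (k) => [|j IHj]; first by rewrite mul0r subr0 expr0.
  rewrite exprS -natr1; have hh : 0 <= 1 - h by lra.
  apply: le_trans (ler_wpM2l hh IHj).
  have := mulr_ge0 (mulr_ge0 (ler0n R j) (ltW h0)) (ltW h0).
  lra.
have : k%:R * h + h = k.+1%:R * h by rewrite -natr1 mulrDl mul1r.
lra.
Qed.

Lemma near0_lt (f : R -> R) (c : R) : (f y @[y --> 0] --> f 0)%classic -> f 0 < c ->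
  (\forall y \near 0^'+, f y < c)%classic.
Proof.
move=> fc f0c; apply: (@cvgr_lt _ _ _ _ f (f 0)) => //.
exact: cvg_at_right_filter.
Qed.

Lemma bernoulli2 (a : R) k : 0 <= a -> 2 * k%:R * a <= 1 ->
  (1 + a) ^+ k <= 1 + 2 * k%:R * a.
Proof.
move=> a0; elim: k => [|k IHk]; first by rewrite mulr0 mul0r addr0 expr0.
rewrite -natr1 => le.
have ak0 : 0 <= k%:R * a by rewrite mulr_ge0.
have ka : 2 * k%:R * a <= 1 by lra.
have kaa : 2 * k%:R * a * a <= a by rewrite ler_piMl.
rewrite exprS; apply: le_trans (ler_wpM2l _ (IHk ka)) _; lra.
Qed.

End ExponentiallySmall.

(** * Exponential rates and the choice of parameters *)

Section Asymptotics.
Variable R : realType.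

(** Chernoff bound with base exp sigma, using exp sigma - 1 <= sigma / (1 - sigma). The prefactor
    exp sigma pays for the floor in N > alpha n - 1. *)
Lemma chernoff_rate (x sigma alpha y : R) (n N D e : nat) :
  0 < x -> 0 < sigma -> sigma < 1 -> alpha * n%:R < N%:R + 1 -> (e <= N)%N ->
  (0 < D)%N -> (D * e <= n)%N -> 0 <= y -> y <= sigma ->
  (1 + (expR sigma - 1) * (x + y)) ^+ n / expR sigma ^+ (N - e) <=
  expR sigma * expR (- (sigma * (alpha - D%:R^-1 - (x + sigma) / (1 - sigma)))) ^+ n.
Proof.
move=> x0 s0 s1 aN eN D0 De y0 ys.
have s1' : 0 < 1 - sigma by rewrite subr_gt0.
have Dr : 0 < D%:R :> R by rewrite ltr0n.
have l1 : expR sigma <= (1 - sigma)^-1.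
  by rewrite -[expR sigma]invrK -expRN lef_pV2 ?posrE ?expR_gt0// expR_ge1Dx.
have l2 : expR sigma - 1 <= sigma / (1 - sigma).
  suff : sigma / (1 - sigma) = (1 - sigma)^-1 - 1 by lra.
  by field; lra.
have l3 : 0 <= expR sigma - 1 by have := expR_ge1Dx sigma; lra.
set c := alpha - _ - _.
have l4 : 1 + (expR sigma - 1) * (x + y) <= expR (sigma / (1 - sigma) * (x + sigma)).
  apply: le_trans (expR_ge1Dx _); rewrite lerD2l; apply: ler_pM => //; lra.
have l5 : (1 + (expR sigma - 1) * (x + y)) ^+ n <=
    expR (n%:R * (sigma / (1 - sigma) * (x + sigma))).
  rewrite expRM_natl; apply: lerXn2r => //; rewrite nnegrE ?expR_ge0//.
  by rewrite addr_ge0// mulr_ge0//; lra.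
rewrite ler_pdivrMr ?exprn_gt0 ?expR_gt0//.
apply: le_trans l5 _; rewrite -!expRM_natl -!expRD ler_expR natrB//.
have De' : e%:R <= n%:R * D%:R^-1 :> R.
  by rewrite ler_pdivlMr// -natrM ler_nat mulnC.
have key : n%:R * (alpha - D%:R^-1) - 1 <= N%:R - e%:R by lra.
have := ler_wpM2l (ltW s0) key; rewrite /c.
have -> : sigma / (1 - sigma) * (x + sigma) = sigma * ((x + sigma) / (1 - sigma)).
  by field; lra.
set w := (x + sigma) / (1 - sigma); set v := D%:R^-1.
move=> key2; nra.
Qed.

(** The tilted sum over a coordinate is at most (1 + sigma)^2. As L <= N / 2, n <= 2 p (N - L),
    which makes the power of [kappa] exponential in n. The p ^ L free choices cost at most (1 +
    sigma) ^ n since p <= (1 + sigma) ^ D and D L <= N <= n. *)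
Lemma few_bound_le (p n N D L : nat) (r2 sigma kappa : R) :
  prime p -> (N <= n)%N -> (n <= p * N)%N -> (2 <= D)%N -> L = (N %/ D)%N ->
  0 < sigma -> 0 <= kappa -> 0 <= r2 <= 1 -> kappa <= r2 ^+ (2 * p) ->
  p%:R <= (1 + sigma) ^+ D ->
  few_bound p n N (n + (N - L)) (1 + sigma) (sigma / p%:R) (p%:R^-1 + sigma) kappa <=
  ((1 + sigma) * (1 + sigma) * r2) ^+ n +
  ((1 + sigma) * (1 + sigma) * (1 + sigma) * (kappa + sigma)) ^+ n +
  ((1 + sigma) * (1 + sigma) * (p%:R^-1 + sigma + sigma) *
     (1 + (p%:R - 1) * (p%:R^-1 + sigma))) ^+ n.
Proof.
move=> p_prime Nn npN D2 LE s0 k0 r01 kr pD.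
have p2 : 2 <= p%:R :> R by rewrite ler_nat prime_gt1.
have pV0 : 0 < p%:R^-1 :> R by rewrite invr_gt0; lra.
set t := sigma / p%:R; set b := 1 + sigma.
have t0 : 0 <= t by rewrite divr_ge0// ltW.
have pt : (p%:R - 1) * t <= sigma.
  suff -> : (p%:R - 1) * t = sigma - t by lra.
  by rewrite mulrBl mul1r /t [_ * (sigma / _)]mulrC divfK// gt_eqF//; lra.
have bE : b = 1 + sigma by [].
clearbody b; rewrite -bE in pD; have b1 : 1 <= b by lra.
have bt : (p%:R - 1) * (b * t) <= b * sigma by rewrite mulrCA ler_wpM2l//; lra.
have bt0 : 0 <= (p%:R - 1) * (b * t) by rewrite mulr_ge0 ?mulr_ge0//; lra.
have LN : (L <= N)%N by rewrite LE leq_div.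
have DL : (D * L <= N)%N by rewrite LE mulnC leq_divM.
have nL : (n + (N - L) - n = N - L)%N by rewrite addKn.
have mL : (n + N - (n + (N - L)) = L)%N by rewrite subnDl subKn.
rewrite /few_bound nL mL -/t.
have bb : b + (p%:R - 1) * (b * t) <= b * b.
  by rewrite [leRHS](_ : _ = b + b * sigma) ?lerD2l// {2}bE mulrDr mulr1.
have bb0 : 0 <= b + (p%:R - 1) * (b * t) by lra.
have bbn : (b + (p%:R - 1) * (b * t)) ^+ N <= (b * b) ^+ n.
  apply: le_trans (_ : (b * b) ^+ N <= _); first by apply: lerXn2r; rewrite ?nnegrE//; nra.
  by rewrite ler_weXn2l//; nra.
rewrite -[leLHS]addrA -[leRHS]addrA; apply: lerD; last apply: lerD.
- rewrite exprMn; apply: ler_pM; rewrite ?exprn_ge0//.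
    by apply: lerXn2r; rewrite ?nnegrE//; nra.
  apply: (expr_le_expr k0 r01 kr); apply: leq_trans npN _.
  rewrite -mulnA mulnCA leq_mul2l; apply/orP; right.
  have L2 : (2 * L <= N)%N by apply: leq_trans DL; rewrite leq_mul2r D2 orbT.
  by rewrite mulnBr [(2 * N)%N]mul2n -addnn -addnBA// leq_addr.
- rewrite (_ : b * b * b * (kappa + sigma) = (b * (kappa + sigma)) * (b * b)); last by ring.
  rewrite exprMn; apply: ler_pM; rewrite ?exprn_ge0//; first by rewrite addr_ge0// mulr_ge0//; lra.
  have kb0 : 0 <= kappa * b by rewrite mulr_ge0//; lra.
  by apply: lerXn2r; rewrite ?nnegrE; nra.
rewrite (_ : _ * _ * _ * _ = (b * (p%:R^-1 + sigma + sigma)) *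
  (1 + (p%:R - 1) * (p%:R^-1 + sigma)) * b); last by ring.
have rb0 : 0 <= (p%:R^-1 + sigma) * b by rewrite mulr_ge0//; lra.
have h1 : 1 <= 1 + (p%:R - 1) * (p%:R^-1 + sigma) by rewrite lerDl mulr_ge0//; lra.
rewrite !exprMn -exprMn; apply: ler_pM; rewrite ?mulr_ge0 ?exprn_ge0//; [lra|lra|..].
- apply: ler_pM; rewrite ?exprn_ge0//; [lra|lra| |].
    apply: lerXn2r; rewrite ?nnegrE; [lra|nra|].
    by nra.
  by apply: ler_weXn2l => //; apply: leq_trans Nn; exact: leq_subr.
apply: le_trans (_ : (b ^+ D) ^+ L <= _).
  by apply: lerXn2r; rewrite ?nnegrE ?ler0n ?exprn_ge0//; lra.
by rewrite -exprM ler_weXn2l// (leq_trans DL).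
Qed.

Lemma few_bound_ge0 (p n N i1 : nat) (s t rho kappa : R) : prime p ->
  0 <= s -> 0 <= t -> 0 <= rho -> 0 <= kappa ->
  0 <= few_bound p n N i1 s t rho kappa.
Proof.
move=> p_prime s0 t0 r0 k0.
have p1 : 0 <= p%:R - 1 :> R by rewrite subr_ge0 ler1n prime_gt0.
by rewrite /few_bound !addr_ge0 ?mulr_ge0 ?exprn_ge0 ?addr_ge0 ?mulr_ge0.
Qed.

Lemma inv_expr_divn_le (p D n : nat) (r : R) : prime p -> (0 < D)%N ->
  0 <= r <= 1 -> p%:R^-1 <= r ^+ D -> p%:R^-1 ^+ (n %/ D) <= p%:R * r ^+ n.
Proof.
move=> p_prime D0 r01 pr; have p0 : 0 < p%:R :> R by rewrite ltr0n prime_gt0.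
rewrite -[leLHS](mulVKf (lt0r_neq0 p0)) ler_pM2l// -exprS.
apply: (expr_le_expr _ r01 pr); first by rewrite invr_ge0 ltW.
by rewrite mulnC ltnW// ltn_ceil.
Qed.

(** The powers of p combine into p ^ -L * p ^ (N - e) * p ^ -(N - L) = p ^ -e, and e is proportional
    to n. *)
Lemma zero_bound_le (p n N D L e : nat) (r1 sigma y : R) :
  prime p -> (N <= n)%N -> (L <= N)%N -> (0 < D)%N -> e = (n %/ D)%N ->
  (e <= N)%N -> 0 < sigma -> 0 <= y -> 0 <= r1 <= 1 -> p%:R^-1 <= r1 ^+ D ->
  (1 + p%:R * y) ^+ (N - L) <= 2 ->
  p%:R^-1 ^+ L * zero_bound p n N (n + (N - L)) (1 + sigma) (sigma / p%:R) y (N - e)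
  <= 2 * p%:R * ((1 + sigma) * (1 + sigma) * r1) ^+ n.
Proof.
move=> p_prime Nn LN D0 eE eN s0 y0 r01 pr le2.
have p2 : 2 <= p%:R :> R by rewrite ler_nat prime_gt1.
have p0 : p%:R != 0 :> R by rewrite gt_eqF//; lra.
have xe := inv_expr_divn_le n p_prime D0 r01 pr; rewrite -eE in xe.
rewrite /zero_bound addKn.
set b := 1 + sigma + _; set b2 := (1 + sigma) * (1 + sigma).
have b0 : 0 <= b.
  by rewrite /b addr_ge0 ?mulr_ge0 ?divr_ge0//; lra.
have bb : b <= b2.
  rewrite /b /b2 mulrDr mulr1 lerD2l mulrCA ler_wpM2l//; first by lra.
  have : 0 <= sigma / p%:R by rewrite divr_ge0//; lra.
  suff -> : (p%:R - 1) * (sigma / p%:R) = sigma - sigma / p%:R by lra.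
  by rewrite mulrBl mul1r [_ * (sigma / _)]mulrC divfK.
have b21 : 1 <= b2 by rewrite /b2; nra.
have bn : b ^+ N <= b2 ^+ n.
  apply: le_trans (_ : b2 ^+ N <= _); last by rewrite ler_weXn2l.
  by apply: lerXn2r => //; rewrite nnegrE; lra.
have -> : p%:R^-1 ^+ L * (p%:R ^+ (N - e) * (p%:R^-1 + y) ^+ (N - L) * b ^+ N) =
    p%:R^-1 ^+ e * (1 + p%:R * y) ^+ (N - L) * b ^+ N.
  rewrite (_ : p%:R^-1 + y = p%:R^-1 * (1 + p%:R * y)); last first.
    by rewrite mulrDr mulr1 mulKf.
  rewrite exprMn !mulrA; congr (_ * _ * _).
  rewrite [p%:R^-1 ^+ L * _]mulrC -mulrA -exprD subnKC// -{2}(subnK eN) exprD.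
  by rewrite mulrA -exprMn divff// expr1n mul1r.
rewrite exprMn (_ : 2 * p%:R * _ = (p%:R * r1 ^+ n) * 2 * b2 ^+ n); last by ring.
apply: ler_pM => //; last apply: ler_pM => //.
- by rewrite mulr_ge0// exprn_ge0// ?invr_ge0// addr_ge0// mulr_ge0.
- exact: exprn_ge0.
- by rewrite exprn_ge0// addr_ge0// mulr_ge0.
Qed.

Local Open Scope classical_set_scope.
Local Open Scope ring_scope.

(** Every condition is strict at sigma = 0 and continuous there. *)
Lemma exists_small_parameter (x alpha d r1 r2 kappa p : R) :
  0 < x -> x < 1 -> p * x = 1 -> r1 < 1 -> r2 < 1 -> kappa < 1 ->
  x + d < alpha ->
  exists sigma : R, [/\ 0 < sigma < 1,
    (1 + sigma) * (1 + sigma) * r1 < 1,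
    (1 + sigma) * (1 + sigma) * r2 < 1,
    (1 + sigma) * (1 + sigma) * (1 + sigma) * (kappa + sigma) < 1 &
    (1 + sigma) * (1 + sigma) * (x + sigma + sigma) *
      (1 + (p - 1) * (x + sigma)) < 1 /\
    (x + sigma) / (1 - sigma) < alpha - d].
Proof.
move=> x0 x1 px r11 r21 k1 xd.
have [sigma []] : exists sigma, [/\ 0 < sigma, sigma < 1,
    (1 + sigma) * (1 + sigma) * r1 < 1,
    (1 + sigma) * (1 + sigma) * r2 < 1 &
    [/\ (1 + sigma) * (1 + sigma) * (1 + sigma) * (kappa + sigma) < 1,
    (1 + sigma) * (1 + sigma) * (x + sigma + sigma) *
      (1 + (p - 1) * (x + sigma)) < 1 &
    x + sigma + sigma * (alpha - d) < alpha - d]].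
  near (0 : R)^'+ => sigma; exists sigma; split; [by []| | | |split]; near: sigma.
  - exact: nbhs_right_lt.
  - apply: (@near0_lt _ (fun y => (1 + y) * (1 + y) * r1)).
      by do ?[exact: cvg_cst|exact: cvg_id|apply: cvgM|apply: cvgD].
    by rewrite addr0 !mul1r.
  - apply: (@near0_lt _ (fun y => (1 + y) * (1 + y) * r2)).
      by do ?[exact: cvg_cst|exact: cvg_id|apply: cvgM|apply: cvgD].
    by rewrite addr0 !mul1r.
  - apply: (@near0_lt _ (fun y => (1 + y) * (1 + y) * (1 + y) * (kappa + y))).
      by do ?[exact: cvg_cst|exact: cvg_id|apply: cvgM|apply: cvgD].
    by rewrite !addr0 !mul1r.
  - apply: (@near0_lt _ (fun y => (1 + y) * (1 + y) * (x + y + y) *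
        (1 + (p - 1) * (x + y)))).
      by do ?[exact: cvg_cst|exact: cvg_id|apply: cvgM|apply: cvgD].
    (* At 0 the value is x (2 - x) = 1 - (1 - x)^2. *)
    rewrite !addr0 !mul1r mulrBl px mul1r; nra.
  (* The last condition with the denominator 1 - sigma cleared, so that it is polynomial in
     sigma. *)
  - apply: (@near0_lt _ (fun y => x + y + y * (alpha - d))).
      by do ?[exact: cvg_cst|exact: cvg_id|apply: cvgM|apply: cvgD].
    by rewrite !addr0 mul0r addr0; lra.
move=> s0 s1 c1 c2 [c3 c4 c5]; exists sigma; split=> //; first by rewrite s0.
by split=> //; rewrite ltr_pdivrMr ?subr_gt0//; lra.
Unshelve. all: by end_near.
Qed.

Lemma exists_expr_ge (a c : R) : 1 < a -> exists D : nat, (2 <= D)%N /\ c <= a ^+ D.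
Proof.
move=> a1; pose D := (Num.truncn (`|c| / (a - 1))).+2.
have a0 : 0 < a - 1 by rewrite subr_gt0.
exists D; split=> //.
have cD : c <= D%:R * (a - 1).
  rewrite -ler_pdivrMr//; apply: le_trans (_ : `|c| / (a - 1) <= _).
    by rewrite ler_pM2r ?invr_gt0// ler_norm.
  by apply/ltW/(lt_le_trans (truncnS_gt _)); rewrite ler_nat.
apply: (le_trans cD); apply: le_trans (_ : 1 + D%:R * (a - 1) <= _); first by lra.
elim: (D) => [|j IHj]; first by rewrite mul0r addr0 expr0.
rewrite exprS -natr1; have := ler_wpM2l (ltW (lt_trans ltr01 a1)) IHj.
have : 0 <= j%:R * (a - 1) * (a - 1) by rewrite mulr_ge0 ?mulr_ge0 ?ler0n//; lra.
lra.
Qed.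

Lemma exp_eventually_le (r c : R) : 0 <= r -> r < 1 -> 0 < c ->
  exists n0, forall n, (n0 <= n)%N -> r ^+ n <= c.
Proof.
move=> r0 r1 c0.
have [->|rn0] := eqVneq r 0.
  by exists 1%N => -[//|n] _; rewrite exprS mul0r ltW.
have r_gt0 : 0 < r by rewrite lt_neqAle eq_sym rn0.
have rV1 : 1 < r^-1 by rewrite invf_gt1.
have [D [_ cD]] := exists_expr_ge c^-1 rV1.
exists D => n Dn; apply: le_trans (_ : r ^+ D <= _); first by rewrite ler_wiXn2l// ltW.
by rewrite -[r]invrK exprVn -[leRHS]invrK lef_pV2// posrE ?exprn_gt0 ?invr_gt0.
Qed.

End Asymptotics.

Theorem theorem1p1 (R : realType) (p : nat) (q alpha : R)
    (p_prime : prime p) (q_gt0 : 0 < q) (q_lt1 : q < 1)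
    (alpha_gt : p%:R^-1 < alpha) (alpha_le1 : alpha <= 1) :
  exists (C K : R) (n0 : nat), [/\ 0 < C, 0 < K &
    forall n : nat, (n0 <= n)%N ->
    let N := Num.truncn (alpha * n%:R) in
    forall k : nat, (k <= n + N)%N ->
    `| bip_prob q (fun G : digraph (n + N) =>
                     corank (mx_mod p (laplacian G)) == (1 + k)%N)
       - limit_law R p k |
    <= K * expR (- (C * n%:R / p%:R ^+ 2))].
Proof.
have p2 : 2 <= p%:R :> R by rewrite ler_nat prime_gt1.
have p_gt0 : 0 < p%:R :> R by lra.
set x : R := p%:R^-1 in alpha_gt *.
have x0 : 0 < x by rewrite invr_gt0.
have x1 : x < 1 by rewrite invf_lt1//; lra.
have px : p%:R * x = 1 by rewrite /x divff// gt_eqF.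
set kappa := Num.max q (1 - q).
have k0 : 0 <= kappa by rewrite le_max (ltW q_gt0).
have k1 : kappa < 1 by rewrite gt_max q_lt1 ltrBlDr ltrDl.
(* 1 / D0 is the slack between alpha and 1/p: the threshold for zero diagonal entries will be N - n
   / D0. The bound p <= D0 makes this subtraction exact. *)
have [D0 [pD0 xD0]] : exists D0 : nat, (p <= D0)%N /\ x + D0%:R^-1 < alpha.
  have ax0 : 0 < alpha - x by rewrite subr_gt0.
  pose T := (Num.truncn (alpha - x)^-1).+1.
  have T0 : 0 < (p + T)%:R :> R by rewrite ltr0n addnS.
  exists (p + T)%N; rewrite leq_addr; split=> //.
  rewrite -ltrBrDl -[ltRHS]invrK ltf_pV2 ?posrE ?invr_gt0//.
  by apply: (lt_le_trans (truncnS_gt _)); rewrite ler_nat leq_addl.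
have D0_gt0 : (0 < D0)%N by rewrite (leq_trans (prime_gt0 p_prime)).
have [r1 r1_itv xr1] := exists_root D0 (ltW x0) x1.
have [r2 r2_itv kr2] := exists_root (2 * p) k0 k1.
have /andP[r1_gt0 r1_lt1] := r1_itv; have /andP[r2_gt0 r2_lt1] := r2_itv.
have [sigma [/andP[s0 s1] c1 c2 c3 [c4 c5]]] :=
  exists_small_parameter x0 x1 px r1_lt1 r2_lt1 k1 xD0.
have sigma1 : 1 < 1 + sigma by rewrite ltrDl.
(* One choice gives both p <= (1 + sigma) ^ D, for the free coordinates, and [sDt], for the tilt
   with t = sigma / p. *)
have [D [D2 sD]] := exists_expr_ge (p%:R / sigma) sigma1.
have pD : p%:R <= (1 + sigma) ^+ D.
  by apply: le_trans sD; rewrite ler_pdivlMr// ler_piMr// ltW.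
have sDt : 1 <= (1 + sigma) ^+ D * (sigma / p%:R).
  by rewrite mulrA ler_pdivlMr// mul1r -ler_pdivrMr.
have /andP[cr0 cr1] := conc_rate_itv p q_gt0 q_lt1.
have [r /andP[r_gt0 r_lt1] cr] := exists_root (p * D) (ltW cr0) cr1.
have [r3 /andP[r3_gt0 r3_lt1] xr3] := exists_root (p * D) (ltW x0) x1.
have r_itv : 0 <= r <= 1 by rewrite !ltW.
have r3_itv : 0 <= r3 <= 1 by rewrite !ltW.
have {}r1_itv : 0 <= r1 <= 1 by rewrite !ltW.
have {}r2_itv : 0 <= r2 <= 1 by rewrite !ltW.
set c := alpha - D0%:R^-1 - (x + sigma) / (1 - sigma).
have c_gt0 : 0 < c by rewrite /c subr_gt0.
pose g0 := expR (- (sigma * c)).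
set g1 := (1 + sigma) * (1 + sigma) * r1 in c1.
set g2 := (1 + sigma) * (1 + sigma) * r2 in c2.
set g3 := (1 + sigma) * (1 + sigma) * (1 + sigma) * (kappa + sigma) in c3.
set g4 := _ * _ * (x + sigma + sigma) * _ in c4.
(* The terms with g0 and g1 come from zero diagonal entries, those with g2, g3, g4 from [few_bound],
   those with r from equidistribution, and those with r3 from x ^ L. *)
pose E (n : nat) : R := 2 * expR sigma * g0 ^+ n + (4 * p%:R + 2) * (n%:R * r ^+ n) +
  2 * p%:R * g2 ^+ n + 2 * p%:R * g3 ^+ n + 2 * p%:R * g4 ^+ n +
  (p%:R * p%:R + 4 * p%:R) * r3 ^+ n + p%:R * (2 * p%:R) * g1 ^+ n.
have E_small : exp_small E.
  have g0_lt1 : g0 < 1 by rewrite /g0 expR_lt1 oppr_lt0 mulr_gt0.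
  have b0 : 0 <= 1 + sigma by lra.
  have px0 : 0 <= p%:R - 1 :> R by lra.
  have pp : 0 <= p%:R * p%:R :> R by rewrite mulr_ge0.
  rewrite /E; repeat apply: exp_smallD.
  - by apply: exp_small_geo; rewrite ?mulr_ge0 ?expR_ge0.
  - by apply: exp_small_linear => //; lra.
  - by apply: exp_small_geo; rewrite ?mulr_ge0 ?(ltW r2_gt0).
  - by apply: exp_small_geo; rewrite ?mulr_ge0 ?addr_ge0 ?(ltW s0).
  - apply: exp_small_geo; rewrite ?mulr_ge0//; first by lra.
    by rewrite addr_ge0// mulr_ge0//; lra.
  - by apply: exp_small_geo; [lra|rewrite ltW|].
  - by apply: exp_small_geo; rewrite ?mulr_ge0 ?(ltW r1_gt0).
have [C [K [n1 [C0 K0 EK]]]] : exists C K n1, [/\ 0 < C, 0 < K &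
    forall n, (n1 <= n)%N -> E n <= K * expR (- (C * n%:R / p%:R ^+ 2))].
  by apply: exp_small_expR => //; rewrite exprn_gt0.
have [n2 rn2] := exp_eventually_le (ltW r_gt0) r_lt1 s0.
have [n3 rn3] : exists n3, forall n, (n3 <= n)%N -> 4 * p%:R * (n%:R * r ^+ n) <= 1.
  have p4 : 0 <= 4 * p%:R :> R by rewrite mulr_ge0.
  have [r' [K' [n3 [r'0 r'1 K'0 bound]]]] := exp_small_linear p4 r_gt0 r_lt1.
  have K1 : 0 < (K' + 1)^-1 by rewrite invr_gt0; lra.
  have [n4 rn4] := exp_eventually_le (ltW r'0) r'1 K1.
  exists (maxn n3 n4) => n; rewrite geq_max => /andP[/bound le /rn4 le'].
  apply: (le_trans le); apply: le_trans (ler_wpM2l K'0 le') _.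
  by rewrite ler_pdivrMr ?mul1r ?lerDl// -invr_gt0.
(* From here on (alpha - x) n >= 1, so n <= p N in spite of the floor; n >= p D then gives D <= N,
   hence L > 0. *)
pose n4 := (Num.truncn (alpha - x)^-1).+1.
exists C, K, (maxn (maxn n1 n2) (maxn n3 (maxn n4 (p * D)))); split=> // n.
rewrite !geq_max -!andbA => /and5P[nn1 nn2 nn3 nn4 nD] N k _.
apply: le_trans (EK n nn1).
have n_gt0 : (0 < n)%N by exact: leq_trans nn4.
have alpha0 : 0 <= alpha by exact/ltW/(lt_trans x0).
have aN : alpha * n%:R < N%:R + 1 by rewrite natr1 truncnS_gt.
have Nn : (N <= n)%N.
  rewrite -(ler_nat R); apply: le_trans (_ : alpha * n%:R <= _).
    by rewrite truncn_le// mulr_ge0.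
  by rewrite ler_piMl.
have npN : (n <= p * N)%N.
  have an : 1 <= (alpha - x) * n%:R.
    rewrite mulrC -ler_pdivrMr ?subr_gt0// div1r.
    by apply/ltW/(lt_le_trans (truncnS_gt _)); rewrite ler_nat.
  rewrite -(ler_nat R) natrM (_ : n%:R = p%:R * (x * n%:R)); last first.
    by rewrite mulrA px mul1r.
  by rewrite ler_pM2l//; lra.
have DN : (D <= N)%N by rewrite -(leq_pmul2l (prime_gt0 p_prime)) (leq_trans nD).
set L := (N %/ D)%N.
have D_gt0 : (0 < D)%N by apply: leq_trans D2.
have L0 : (0 < L)%N by rewrite divn_gt0.
have LN : (L <= N)%N by exact: leq_div.
set e := (n %/ D0)%N.
have D0e : (D0 * e <= n)%N by rewrite mulnC leq_divM.
have eN : (e <= N)%N.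
  rewrite -(leq_pmul2l D0_gt0) (leq_trans D0e)// (leq_trans npN)//.
  by rewrite leq_pmul2r// (leq_trans L0).
have rn := rn2 n nn2; have rn0 : 0 <= r ^+ n by rewrite exprn_ge0 ?(ltW r_gt0).
have xr : x + r ^+ n <= x + sigma by rewrite lerD2l.
have st0 : 0 < sigma / p%:R by rewrite divr_gt0.
have l1 : 1 <= expR sigma by rewrite -expR0 ler_expR ltW.
pose few := few_bound p n N (n + (N - L)) (1 + sigma) (sigma / p%:R) (x + sigma) kappa.
have main := corank_law_bound (N - e) k p_prime q_gt0 q_lt1 D2 npN L0 LN (ltW sigma1) st0
  sDt r_itv cr xr l1 (erefl few).
apply: (le_trans main).
have B1 := chernoff_rate x0 s0 s1 aN eN D0_gt0 D0e rn0 rn.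
rewrite -/c -/g0 in B1.
have B3 : few <= g2 ^+ n + g3 ^+ n + g4 ^+ n.
  exact: (few_bound_le p_prime Nn npN D2 (erefl _) s0 k0 r2_itv kr2 pD).
have iN : (n + (N - L) <= 2 * n)%N.
  by rewrite mul2n -addnn leq_add2l (leq_trans (leq_subr _ _)).
have pr0 : 0 <= p%:R * r ^+ n by rewrite mulr_ge0.
have i2n : 2 * (n + (N - L))%:R * (p%:R * r ^+ n) <= 4 * p%:R * (n%:R * r ^+ n).
  rewrite (_ : 4 * p%:R * _ = 2 * (2 * n)%:R * (p%:R * r ^+ n)); last first.
    by rewrite natrM; ring.
  by rewrite ler_wpM2r// ler_wpM2l// ler_nat.
have small := rn3 n nn3.
have B2 : (1 + p%:R * r ^+ n) ^+ (n + (N - L)) <= 1 + 4 * p%:R * (n%:R * r ^+ n).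
  apply: le_trans (bernoulli2 pr0 (le_trans i2n small)) _.
  by rewrite lerD2l.
have B2' : (1 + p%:R * r ^+ n) ^+ (N - L) <= 2.
  apply: le_trans (_ : (1 + p%:R * r ^+ n) ^+ (n + (N - L)) <= _); last by lra.
  by rewrite ler_weXn2l ?leq_addl// lerDl.
have B5 := zero_bound_le p_prime Nn LN D0_gt0 (erefl _) eN s0 rn0 r1_itv xr1 B2'.
rewrite -/x -/g1 in B5.
have B4 : x ^+ L <= p%:R * r3 ^+ n.
  rewrite -[leLHS](mulVKf (lt0r_neq0 p_gt0)) ler_pM2l// -exprS.
  apply: (expr_le_expr (ltW x0) r3_itv xr3); apply: leq_trans npN _.
  by rewrite -mulnA leq_mul2l mulnC ltnW ?orbT// ltn_ceil.
have xL0 : 0 <= x ^+ L by rewrite exprn_ge0// ltW.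
have xL1 : x ^+ L <= 1 by rewrite exprn_ile1// ltW.
have B6 : L%:R * (2 * r ^+ n) <= 2 * (n%:R * r ^+ n).
  by rewrite mulrCA ler_wpM2l// ler_wpM2r// ler_nat (leq_trans LN).
have few0 : 0 <= few.
  by apply: few_bound_ge0; rewrite ?(ltW st0) ?addr_ge0 ?(ltW x0) ?(ltW s0).
have B7 : x ^+ L * (p%:R * few) <= p%:R * few by rewrite ler_piMl// mulr_ge0.
have B8 : p%:R * few <= p%:R * (g2 ^+ n + g3 ^+ n + g4 ^+ n) by rewrite ler_wpM2l.
set zb := zero_bound _ _ _ _ _ _ _ _ in B5 *.
have B9 : p%:R * (x ^+ L * zb) <= p%:R * (2 * p%:R * g1 ^+ n) by rewrite ler_wpM2l.
have B10 : p%:R * x ^+ L <= p%:R * (p%:R * r3 ^+ n) by rewrite ler_wpM2l.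
rewrite /E; set A := _ / _ in B1 *.
rewrite [x ^+ L * _]mulrDr [x ^+ L * (_ + _)]mulrDr [x ^+ L * p%:R]mulrC.
rewrite [x ^+ L * (p%:R * zb)]mulrCA.
lra.
Qed.
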